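(* Let $\mathscr{H}$ be a separable complex Hilbert space, let $0<p<\infty$, let $A_1,\dots,A_n\in\mathcal{C}_p$ be operators on $\mathscr{H}$ in the Schatten $p$-class, and let $r_1,\dots,r_n$ be positive real numbers with $\sum_{i=1}^n\frac1{r_i}=1$. If $2\le p<\infty$, then $$\sum_{i=1}^n r_i^{p-1}\|A_i\|_p^p\ \ge\ \sum_{1\le i<j\le n}\left\|\sqrt{\frac{r_i}{r_j}}A_i-\sqrt{\frac{r_j}{r_i}}A_j\right\|_p^p+\left\|\sum_{i=1}^nA_i\right\|_p^p.$$ If $0<p\le2$, then the reverse inequality holds: $$\sum_{i=1}^n r_i^{p-1}\|A_i\|_p^p\ \le\ \sum_{1\le i<j\le n}\left\|\sqrt{\frac{r_i}{r_j}}A_i-\sqrt{\frac{r_j}{r_i}}A_j\right\|_p^p+\left\|\sum_{i=1}^nA_i\right\|_p^p.$$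
   Context: For a compact operator $A$ on $\mathscr{H}$ and $0<p<\infty$, $\|A\|_p=(\mathrm{tr}\,|A|^p)^{1/p}$, where $|A|=(A^*A)^{1/2}$ and $\mathrm{tr}$ is the usual trace (this is a norm for $p\ge1$ and a quasi-norm for $0<p<1$). The Schatten $p$-class $\mathcal{C}_p$ is the two-sided ideal of $\mathbb{B}(\mathscr{H})$ consisting of compact operators $A$ with $\|A\|_p<\infty$. *)

(* Defs.v *)
From HB Require Import structures.
From mathcomp Require Import all_boot all_order all_algebra complex.
From mathcomp Require Import all_classical all_reals all_analysis.

Set Implicit Arguments.
Unset Strict Implicit.
Unset Printing Implicit Defensive.

Import Order.TTheory GRing.Theory Num.Theory.
Import numFieldNormedType.Exports.

Local Open Scope classical_set_scope.
Local Open Scope complex_scope.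
Local Open Scope ring_scope.

(* The inner product is linear in its first argument and conjugate-linear in
   its second one; the norm of a normed module over R[i] takes its values in
   the nonnegative reals of R[i]. *)
HB.mixin Record isHilbert (R : realType) H
    of CompleteNormedModule R[i] H := {
  inner : {dot H for (@Num.conj R[i])} ;
  inner_normE : forall x : H, `|x| ^+ 2 = inner x x }.

#[short(type="hilbertType")]
HB.structure Definition Hilbert (R : realType) :=
  {H of isHilbert R H & CompleteNormedModule R[i] H}.

Definition separable (T : topologicalType) :=
  exists2 S : set T, countable S & dense S.

Section Operators.
Variables (R : realType) (H : hilbertType R).
Implicit Types (A P T : H -> H) (B : set H).

Local Notation "'[ x , y ]" := (@inner R H x y).

Definition bounded_operator A := linear A /\ continuous A.

Definition compact_operator A :=
  linear A /\ precompact (A @` [set x : H | `|x| <= 1]).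

Definition adjoint A : H -> H :=
  xget 0 [set A' : H -> H | forall x y, '[A x, y] = '[x, A' y]].

Definition orthonormal_set B :=
  forall e f, B e -> B f -> '[e, f] = (e == f)%:R.

Definition orthonormal_basis B :=
  orthonormal_set B /\ forall x, (forall e, B e -> '[x, e] = 0) -> x = 0.

(* T = P ^ s for a positive operator P that is diagonal in some orthonormal
   basis, as every compact positive operator is by the spectral theorem: T is
   the bounded operator that multiplies each basis vector by the s-th power of
   the corresponding eigenvalue of P. T does not depend on the basis. *)
Definition is_operator_power P (s : R) T :=
  bounded_operator T /\
  exists (B : set H) (lambda : H -> R), orthonormal_basis B /\
    forall e, B e -> [/\ 0 <= lambda e, P e = (lambda e)%:C *: e &
                         T e = (lambda e `^ s)%:C *: e].

Definition operator_power P (s : R) : H -> H := xget 0 (is_operator_power P s).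

Definition operator_abs A : H -> H :=
  operator_power (adjoint A \o A) 2^-1.

(* The trace of a positive operator, for which all the '[T e, e] are
   nonnegative reals; it does not depend on the basis and may be infinite. *)
Definition trace T : \bar R :=
  (\esum_(e in xget set0 orthonormal_basis) (complex.Re '[T e, e])%:E)%E.

Definition schatten_norm (p : R) A : \bar R :=
  (trace (operator_power (operator_abs A) p) `^ p^-1)%E.

Definition schatten_class (p : R) : set (H -> H) :=
  [set A | compact_operator A /\ (schatten_norm p A < +oo)%E].

End Operators.

(* Main.v *)
(** Put [q = p / 2]. The parallelogram-type identity
      [sum_i r_i |A_i|^2
         = sum_(i<j) |sqrt (r_i/r_j) A_i - sqrt (r_j/r_i) A_j|^2 + |sum_i A_i|^2]
    holds for the quadratic forms [x |-> |A x|^2]. Write [S_k] for the operators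
    on the right, and let [e] range over an orthonormal eigenbasis of the
    common operator [Z], with eigenvalues [z_e].

    - Convexity: [z_e = sum_i 1/r_i * (r_i^2 |A_i e|^2)], and
      [|A_i e|^2 = sum_g mu_g^2 |<e,g>|^2] over the singular vectors [g] of
      [A_i]. Jensen's inequality for [t |-> t^q], summed over [e], compares
      [sum_e z_e^q] with [sum_i r_i^(p-1) |A_i|_p^p].
    - Pinching: a squared singular value [s] of [S_k] with right singular vector
      [g] is [sum_e w_e z_e] with [w_e = s |<g,e>|^2 / z_e]. These weights have
      total at most 1 when summed over [e], and total exactly 1 when summed over
      all [k] and [g] (if [z_e > 0]), so Jensen's inequality compares
      [sum_k |S_k|_p^p] with [sum_e z_e^q].

    Both comparisons reverse when [q <= 1], since [t^q] is then concave and
    vanishes at 0. The eigenbasis of [Z] is a maximal orthonormal set of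
    eigenvectors: a maximizing sequence of the quadratic form on the unit sphere
    of its orthogonal complement would have a Cauchy subsequence, whose limit is
    a further eigenvector. *)

Require Import Defs.
From HB Require Import structures.
From mathcomp Require Import all_boot all_order all_algebra complex.
From mathcomp Require Import all_classical all_reals all_analysis.
From mathcomp Require Import finmap ring lra.

Set Implicit Arguments.
Unset Strict Implicit.
Unset Printing Implicit Defensive.

Import Order.TTheory GRing.Theory Num.Theory.
Import numFieldNormedType.Exports.

Local Open Scope classical_set_scope.
Local Open Scope complex_scope.
Local Open Scope ring_scope.

Local Notation "x ^*" := (conjc x) : ring_scope.

(** * Complex moduli and inner products *)

Section Modulus.
Variable R : realType.
Implicit Types (c d : R[i]) (k : R).

(** Taken in [R] rather than as a norm in [R[i]], so that all estimates are inequalities between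
    reals; [sqn] does the same for vectors. *)
Definition csq c : R := complex.Re c ^+ 2 + complex.Im c ^+ 2.

Lemma csq_ge0 c : 0 <= csq c.
Proof. by rewrite addr_ge0 // sqr_ge0. Qed.

Lemma csq0 : csq 0 = 0.
Proof. by rewrite /csq /= expr0n addr0. Qed.

Lemma csq_eq0 c : (csq c == 0) = (c == 0).
Proof. by case: c => a b; rewrite /csq paddr_eq0 ?sqr_ge0 // !sqrf_eq0 eq_complex. Qed.

Lemma csqJ c : csq c^* = csq c.
Proof. by case: c => a b; rewrite /csq /= sqrrN. Qed.

Lemma csqN c : csq (- c) = csq c.
Proof. by case: c => a b; rewrite /csq /= !sqrrN. Qed.

Lemma csqM c d : csq (c * d) = csq c * csq d.
Proof. by case: c d => a b [a' b']; rewrite /csq /=; ring. Qed.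

Lemma csqr k : csq k%:C = k ^+ 2.
Proof. by rewrite /csq /= expr0n addr0. Qed.

Lemma conjM c d : (c * d)^* = c^* * d^*.
Proof. exact: (rmorphM (@conjc R)). Qed.

Lemma conj_realM k c : (k%:C * c)^* = k%:C * c^*.
Proof. by rewrite conjM conjc_real. Qed.

Lemma csqE c : (csq c)%:C = c * c^*.
Proof.
by case: c => a b; apply/eqP; rewrite eq_complex /csq /=; apply/andP; split;
  apply/eqP; ring.
Qed.

Lemma ReD c d : complex.Re (c + d) = complex.Re c + complex.Re d.
Proof. by case: c d => ? ? []. Qed.

Lemma ReN c : complex.Re (- c) = - complex.Re c.
Proof. by case: c. Qed.

Lemma ReB c d : complex.Re (c - d) = complex.Re c - complex.Re d.
Proof. by rewrite ReD ReN. Qed.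

Lemma ReJ c : complex.Re c^* = complex.Re c.
Proof. by case: c. Qed.

Lemma Re_realM k c : complex.Re (k%:C * c) = k * complex.Re c.
Proof. by case: c => a b /=; rewrite mul0r subr0. Qed.

Lemma Re_sum I (r : seq I) (P : pred I) (F : I -> R[i]) :
  complex.Re (\sum_(i <- r | P i) F i) = \sum_(i <- r | P i) complex.Re (F i).
Proof. by apply: (big_morph _ ReD). Qed.

(* The discriminant argument behind the Cauchy-Schwarz inequality. *)
Lemma discriminant_le (a b : R) c : 0 <= b ->
  (forall t : R[i], 0 <= a + complex.Re (t * c) *+ 2 + csq t * b) ->
  csq c <= a * b.
Proof.
move=> b0 h; have [b_gt0|] := ltP 0 b; last first.
  move=> b_le0; have {b0 b_le0} b_eq0 : b = 0 by apply/eqP; rewrite eq_le b_le0.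
  subst b; rewrite mulr0 leNgt; apply/negP => c_gt0.
  (* For [b = 0] this [t] turns the expression into [a - 2 (a + 1)], which is negative because
     [t = 0] gives [0 <= a]. *)
  have := h ((- (a + 1) / csq c)%:C * c^*).
  rewrite mulr0 addr0 -mulrA [c^* * c]mulrC -csqE Re_realM /=.
  rewrite divfK ?gt_eqF // => h1.
  by have := h 0; rewrite mul0r /=; lra.
(* This [t] minimizes the quadratic; the minimum is [(a b - csq c) / b]. *)
have := h ((- b^-1)%:C * c^*).
rewrite -mulrA [c^* * c]mulrC -csqE Re_realM /= csqM csqJ csqr.
have -> : a + - b^-1 * csq c *+ 2 + (- b^-1) ^+ 2 * csq c * b =
  (a * b - csq c) / b by field; rewrite gt_eqF.
by rewrite pmulr_lge0 ?invr_gt0 // subr_ge0.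
Qed.

End Modulus.

Section InnerProduct.
Variables (R : realType) (H : hilbertType R).
Implicit Types (x y z u v : H) (c : R[i]) (k : R).

Local Notation "'[ x , y ]" := (@inner R H x y).

Definition sqn x : R := complex.Re '[x, x].

Lemma ipC x y : '[y, x] = '[x, y]^*.
Proof. by rewrite (hermC (@inner R H)) /= expr0 mul1r. Qed.

Lemma ipDl x y z : '[x + y, z] = '[x, z] + '[y, z].
Proof. exact: linearDl. Qed.
Lemma ipDr x y z : '[z, x + y] = '[z, x] + '[z, y].
Proof. exact: linearDr. Qed.
Lemma ipNl x z : '[- x, z] = - '[x, z].
Proof. exact: linearNl. Qed.
Lemma ipNr x z : '[z, - x] = - '[z, x].
Proof. exact: linearNr. Qed.
Lemma ipBl x y z : '[x - y, z] = '[x, z] - '[y, z].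
Proof. exact: linearBl. Qed.
Lemma ipBr x y z : '[z, x - y] = '[z, x] - '[z, y].
Proof. exact: linearBr. Qed.
Lemma ip0r x : '[x, 0] = 0.
Proof. exact: linear0r. Qed.
Lemma ipZl c x y : '[c *: x, y] = c * '[x, y].
Proof. exact: linearZl_LR. Qed.
Lemma ipZr c x y : '[x, c *: y] = c^* * '[x, y].
Proof. exact: (linearZr_LR (@inner R H)). Qed.

Lemma ip_suml I (r : seq I) (P : pred I) (F : I -> H) x :
  '[\sum_(i <- r | P i) F i, x] = \sum_(i <- r | P i) '[F i, x].
Proof. exact: linear_sumlz. Qed.
Lemma ip_sumr I (r : seq I) (P : pred I) (F : I -> H) x :
  '[x, \sum_(i <- r | P i) F i] = \sum_(i <- r | P i) '[x, F i].
Proof. exact: linear_sumr. Qed.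

Lemma sqn_norm x : (sqn x)%:C = `|x| ^+ 2.
Proof.
rewrite inner_normE /sqn RRe_real // -inner_normE.
by rewrite realX // normr_real.
Qed.

Lemma ipxx x : '[x, x] = (sqn x)%:C.
Proof. by rewrite sqn_norm inner_normE. Qed.

Lemma sqn_ge0 x : 0 <= sqn x.
Proof. by rewrite -lecR sqn_norm exprn_ge0. Qed.

Lemma normE x : `|x| = (Num.sqrt (sqn x))%:C.
Proof.
apply/eqP; rewrite -(@eqrXn2 _ 2) ?lecR ?sqrtr_ge0 //.
by rewrite -rmorphXn /= sqr_sqrtr ?sqn_ge0 // sqn_norm.
Qed.

Lemma sqn_eq0 x : (sqn x == 0) = (x == 0).
Proof. by rewrite -(inj_eq (@complexI R)) sqn_norm sqrf_eq0 normr_eq0. Qed.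

Lemma sqn0 : sqn 0 = 0.
Proof. by apply/eqP; rewrite sqn_eq0. Qed.

Lemma Re_ipC x y : complex.Re '[y, x] = complex.Re '[x, y].
Proof. by rewrite ipC ReJ. Qed.

Lemma sqnD x y : sqn (x + y) = sqn x + sqn y + complex.Re '[x, y] *+ 2.
Proof. by rewrite /sqn ipDl !ipDr !ReD (Re_ipC x y); ring. Qed.

Lemma sqnN x : sqn (- x) = sqn x.
Proof. by rewrite /sqn ipNl ipNr opprK. Qed.

Lemma sqnB x y : sqn (x - y) = sqn x + sqn y - complex.Re '[x, y] *+ 2.
Proof. by rewrite sqnD sqnN ipNr ReN mulNrn. Qed.

Lemma sqn_subC x y : sqn (x - y) = sqn (y - x).
Proof. by rewrite -sqnN opprB. Qed.

Lemma sqnZ c x : sqn (c *: x) = csq c * sqn x.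
Proof. by rewrite /sqn ipZl ipZr mulrA -csqE Re_realM. Qed.

Lemma parallelogram x y : sqn (x + y) + sqn (x - y) = (sqn x + sqn y) *+ 2.
Proof. by rewrite sqnD sqnB; ring. Qed.

Lemma sqnD_le x y : sqn (x + y) <= (sqn x + sqn y) *+ 2.
Proof. by rewrite -parallelogram lerDl sqn_ge0. Qed.

Lemma sqnB_le x y : sqn (x - y) <= (sqn x + sqn y) *+ 2.
Proof. by rewrite -parallelogram lerDr sqn_ge0. Qed.

Lemma cauchy_schwarz x y : csq '[x, y] <= sqn x * sqn y.
Proof.
apply: discriminant_le (sqn_ge0 _) _ => t.
have := sqn_ge0 (x + t^* *: y); rewrite sqnD ipZr. by rewrite conjcK sqnZ csqJ addrAC.
Qed.

End InnerProduct.

(** * Sequential continuity and compactness *)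

Section Sequences.
Variables (R : realType) (H : hilbertType R).
Implicit Types (x y z : H) (u v : nat -> H) (A : H -> H).

Local Notation "'[ x , y ]" := (@inner R H x y).

Definition pack_linear A (lA : linear A) : {linear H -> H} :=
  HB.pack A (GRing.isLinear.Build _ _ _ _ A lA).

Lemma linD A x y : linear A -> A (x + y) = A x + A y.
Proof. by move=> lA; exact: (linearD (pack_linear lA)). Qed.
Lemma lin0 A : linear A -> A 0 = 0.
Proof. by move=> lA; exact: (linear0 (pack_linear lA)). Qed.
Lemma linB A x y : linear A -> A (x - y) = A x - A y.
Proof. by move=> lA; exact: (linearB (pack_linear lA)). Qed.
Lemma linZ A c x : linear A -> A (c *: x) = c *: A x.
Proof. by move=> lA; have := lA c x 0; rewrite (lin0 lA) !addr0. Qed.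
Lemma lin_sum A I (r : seq I) (P : pred I) (F : I -> H) : linear A ->
  A (\sum_(i <- r | P i) F i) = \sum_(i <- r | P i) A (F i).
Proof. by move=> lA; exact: (linear_sum (pack_linear lA)). Qed.

Definition sqn_cvg u y :=
  forall e : R, 0 < e -> exists N, forall n, (N <= n)%N -> sqn (u n - y) < e.

Definition sqn_bounded A :=
  exists2 C : R, 0 < C & forall x, sqn (A x) <= C * sqn x.

(** The condition [n <= phi n] stands in for strict monotonicity: it keeps tails inside tails and is
    stable under composition. *)
Definition seq_compact A := forall u, (forall n, sqn (u n) <= 1) ->
  exists (phi : nat -> nat) y,
    (forall n, (n <= phi n)%N) /\ sqn_cvg (fun n => A (u (phi n))) y.

Lemma norm_lt (k : R) x : 0 < k -> (`|x| < k%:C) = (sqn x < k ^+ 2).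
Proof.
move=> k0; rewrite -(@ltr_pXn2r _ 2) // ?nnegrE ?normr_ge0 ?lecR ?ltW //.
by rewrite -sqn_norm -rmorphXn /= ltcR.
Qed.

Lemma norm_le (k : R) x : 0 <= k -> (`|x| <= k%:C) = (sqn x <= k ^+ 2).
Proof.
move=> k0; rewrite -(@ler_pXn2r _ 2) // ?nnegrE ?normr_ge0 ?lecR //.
by rewrite -sqn_norm -rmorphXn /= lecR.
Qed.

Lemma complex_gt0 (e : R[i]) : 0 < e -> exists2 k : R, 0 < k & e = k%:C.
Proof.
by move=> e0; have /complex_realP[k ek] := gtr0_real e0; exists k => //;
  rewrite -ltcR -ek.
Qed.

Lemma sqn_complete u :
  (forall e : R, 0 < e -> exists N, forall n m, (N <= n)%N -> (N <= m)%N ->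
     sqn (u n - u m) < e) ->
  exists y, sqn_cvg u y.
Proof.
move=> uC; have cu : cauchy (u @ \oo).
  apply/cauchy_ballP => _ /complex_gt0[k k0 ->].
  have [|N NP] := uC (k ^+ 2); first by rewrite exprn_gt0.
  pose T := [set u n | n in [set n | (N <= n)%N]].
  have FT : (u @ \oo) T by exists N => // n /= Nn; exists n.
  exists (T, T); first by split.
  case=> _ _ /= [[n /= Nn <-] [m /= Nm <-]].
  by rewrite -ball_normE /= norm_lt // NP.
have [y uy] := (cvg_ex _).1 (cauchy_cvg _ cu).
exists y => e e0; have k0 : 0 < (Num.sqrt e)%:C by rewrite ltcR sqrtr_gt0.
have [N _ NP] := cvgr_dist_lt _ _ uy _ k0.
exists N => n /NP; rewrite /= norm_lt ?sqrtr_gt0 // sqr_sqrtr ?ltW //.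
by rewrite sqn_subC.
Qed.

Lemma bounded_operator_sqn A : bounded_operator A -> sqn_bounded A.
Proof.
move=> [lA cA]; pose A' := pack_linear lA.
have /linear_bounded_continuous/linear_boundedP : continuous A' by [].
move=> /pinfty_ex_gt0[_ /complex_gt0[k k0 ->] kP].
exists (k ^+ 2) => [|x]; first by rewrite exprn_gt0.
have := kP x; rewrite /= (normE x) -rmorphM /= norm_le ?mulr_ge0 ?sqrtr_ge0 ?(ltW k0) //.
by rewrite exprMn sqr_sqrtr ?sqn_ge0.
Qed.

Lemma sqn_bounded_operator A : linear A -> sqn_bounded A -> bounded_operator A.
Proof.
move=> lA [C C0 CP]; split => //.
pose A' := pack_linear lA.
suff : continuous A' by [].
apply/linear_bounded_continuous/linear_boundedP.
exists (Num.sqrt C)%:C; split; first by apply/complex_realP; exists (Num.sqrt C).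
move=> r rC x; apply: (@le_trans _ _ ((Num.sqrt C)%:C * `|x|)); last first.
  by rewrite ler_wpM2r // ltW.
rewrite /= (normE x) -rmorphM /= norm_le ?mulr_ge0 ?sqrtr_ge0 //.
by rewrite exprMn !sqr_sqrtr ?sqn_ge0 // ltW.
Qed.

(** The images lie in a compact set, so their filter has a cluster point [y]. The ball around [y] of
    squared radius [1 / (n + 1)] meets every tail, which provides [phi n]. *)
Lemma compact_operator_seq A : compact_operator A -> seq_compact A.
Proof.
move=> [lA [K AK [cK _]]] u u1.
have FK : (A \o u @ \oo) K.
  by exists 0%N => // n _ /=; apply: AK; exists (u n) => //=; rewrite norm_le ?expr1n.
have [y [_ yP]] := cK _ _ FK.
have /choice[phi phiP] (n : nat) :
    exists m, (n <= m)%N /\ sqn (A (u m) - y) < n.+1%:R^-1.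
  have k0 : 0 < (Num.sqrt (n.+1%:R^-1 : R))%:C by rewrite ltcR sqrtr_gt0 invr_gt0.
  have [|_ [[m /= nm <-]]] := yP [set A (u m) | m in [set m | (n <= m)%N]] _ _
    (nbhsx_ballx y _ k0).
    by exists n => // m /= nm; exists m.
  rewrite -ball_normE /= norm_lt ?sqrtr_gt0 ?invr_gt0 // sqr_sqrtr ?invr_ge0 //.
  by rewrite sqn_subC => mP; exists m.
exists phi, y; split => [n|e e0]; first by have [] := phiP n.
pose N := Num.truncn e^-1; exists N => n Nn.
have [_ /lt_le_trans] := phiP n; apply.
rewrite -[leRHS]invrK lef_pV2 ?posrE ?invr_gt0 //.
by apply: ltW; apply: lt_le_trans (truncnS_gt _) _; rewrite ler_nat.
Qed.

Lemma sqn_cvg_shift u y (phi : nat -> nat) :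
  (forall n, (n <= phi n)%N) -> sqn_cvg u y -> sqn_cvg (u \o phi) y.
Proof.
move=> phi_ge uy e /uy[N NP]; exists N => n Nn.
by apply: NP; exact: leq_trans (phi_ge n).
Qed.

(** Otherwise there are [u n] in the unit ball with [|A (u n)|^2 > n], and no subsequence of their
    images converges. *)
Lemma seq_compact_bounded A : linear A -> seq_compact A -> sqn_bounded A.
Proof.
move=> lA cA; apply: contrapT => nb.
have /choice[u uP] (n : nat) : exists x, sqn x <= 1 /\ n%:R < sqn (A x).
  apply: contrapT => nx; apply: nb; exists n.+1%:R => // x.
  have [->|x0] := eqVneq x 0.
    by rewrite (lin0 lA) sqn0 mulr0.
  have s0 : 0 < sqn x by rewrite lt_def sqn_eq0 x0 sqn_ge0.
  have cs : csq (Num.sqrt (sqn x))^-1%:C = (sqn x)^-1.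
    by rewrite csqr exprVn sqr_sqrtr // ltW.
  apply: contra_notT nx; rewrite -ltNge => xP.
  exists ((Num.sqrt (sqn x))^-1%:C *: x); rewrite (linZ _ _ lA) !sqnZ cs mulVf ?gt_eqF //.
  split => //; rewrite mulrC ltr_pdivlMr //; apply: le_lt_trans xP.
  by rewrite ler_wpM2r ?ler_nat // ltW.
have [|phi [y [phi_ge]]] := cA u; first by move=> n; case: (uP n).
move=> /(_ 1 ltr01)[N NP].
(* At an index beyond [M], [|A u|^2 <= 2 (|A u - y|^2 + |y|^2) < 2 (1 + |y|^2) < M + 1 <= phi n < |A
   u|^2], a contradiction. *)
pose M := Num.truncn ((1 + sqn y) *+ 2).
have := NP (maxn N M.+1) (leq_maxl _ _); set n := maxn _ _.
have [_ un] := uP (phi n) => h.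
have := sqnD_le (A (u (phi n)) - y) y; rewrite subrK => h2.
have : (M.+1)%:R <= (phi n)%:R :> R.
  by rewrite ler_nat (leq_trans _ (phi_ge n)) // leq_maxr.
have := truncnS_gt ((1 + sqn y) *+ 2); rewrite -/M.
lra.
Qed.

End Sequences.

(** * Fourier series in a Hilbert space *)

Section RealSums.
Variables (R : realType) (T : choiceType).
Implicit Types (B : set T) (f : T -> R) (F : {fset T}).

Lemma esum_fset_le B f F : (forall b, B b -> 0 <= f b) -> [set` F] `<=` B ->
  ((\sum_(b <- F) f b)%:E <= \esum_(b in B) (f b)%:E)%E.
Proof.
move=> f0 FB; rewrite esum_ge //; exists [set` F]; first by split.
by rewrite fsbig_finite //= set_fsetK sumEFin.
Qed.

Lemma esum_le_fset B f (K : \bar R) :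
  (forall F, [set` F] `<=` B -> ((\sum_(b <- F) f b)%:E <= K)%E) ->
  (\esum_(b in B) (f b)%:E <= K)%E.
Proof.
move=> h; apply: ge_ereal_sup => _ [X [finX XB] <-].
rewrite fsbig_finite //= sumEFin; apply: h => x /=.
by rewrite in_fset_set // => /set_mem/XB.
Qed.

Lemma esum_approx B f (K e : R) : \esum_(b in B) (f b)%:E = K%:E -> 0 < e ->
  exists2 F : {fset _}, [set` F] `<=` B & K - e < \sum_(b <- F) f b.
Proof.
move=> sK e0; apply: contrapT => nF.
have : (\esum_(b in B) (f b)%:E <= (K - e)%:E)%E.
  apply: esum_le_fset => F FB; rewrite lee_fin leNgt.
  by apply/negP => KF; apply: nF; exists F.
by rewrite sK lee_fin; apply/negP; rewrite -ltNge gtrDl oppr_lt0.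
Qed.

End RealSums.

Section Fourier.
Variables (R : realType) (H : hilbertType R).
Implicit Types (x y z : H) (A : H -> H) (B : set H) (F G : {fset H})
  (c : H -> R[i]).

Local Notation "'[ x , y ]" := (@inner R H x y).

Definition lcomb c F : H := \sum_(b <- F) c b *: b.

Lemma csqD_le (a b : R[i]) : csq (a + b) <= (csq a + csq b) *+ 2.
Proof.
case: a b => a1 a2 [b1 b2]; rewrite /csq /=.
have := sqr_ge0 (a1 - b1); have := sqr_ge0 (a2 - b2); nra.
Qed.

Lemma ip_lcomb B c F b : orthonormal_set B -> [set` F] `<=` B -> B b ->
  '[lcomb c F, b] = if b \in F then c b else 0.
Proof.
move=> oB FB Bb; rewrite ip_suml.
have E a : a \in F -> '[c a *: a, b] = if a == b then c b else 0.
  move=> aF; rewrite ipZl (oB _ _ (FB _ aF) Bb).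
  by case: eqP => [->|_]; rewrite ?mulr1 ?mulr0.
rewrite big_seq; under eq_bigr => a aF do rewrite (E a aF).
rewrite -big_seq; case: ifPn => bF.
  rewrite (big_fsetD1 b) //= eqxx big_seq big1 ?addr0 // => a.
  by rewrite !inE => /andP[/negPf ->].
by rewrite big_seq big1 // => a aF; case: eqP aF bF => // -> ->.
Qed.

Lemma ip_lcombr x c F :
  '[x, lcomb c F] = \sum_(b <- F) (c b)^* * '[x, b].
Proof. by rewrite ip_sumr; under eq_bigr do rewrite ipZr. Qed.

Lemma ip_lcomb_self x c F : (forall b, b \in F -> '[x, b] = c b) ->
  '[x, lcomb c F] = (\sum_(b <- F) csq (c b))%:C.
Proof.
move=> xc; rewrite ip_lcombr rmorph_sum /= big_seq [RHS]big_seq.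
by apply: eq_bigr => b bF; rewrite xc // csqE mulrC.
Qed.

Lemma sqn_lcomb B c F : orthonormal_set B -> [set` F] `<=` B ->
  sqn (lcomb c F) = \sum_(b <- F) csq (c b).
Proof.
move=> oB FB; rewrite /sqn ip_lcomb_self // => b bF.
by rewrite (ip_lcomb _ oB FB (FB _ bF)) bF.
Qed.

Lemma sqn_sub_lcomb B c F x : orthonormal_set B -> [set` F] `<=` B ->
  (forall b, b \in F -> '[x, b] = c b) ->
  sqn (x - lcomb c F) = sqn x - \sum_(b <- F) csq (c b).
Proof.
move=> oB FB xc; rewrite sqnB (ip_lcomb_self xc) (sqn_lcomb _ oB FB) /=; ring.
Qed.

Lemma bessel B x : orthonormal_set B ->
  (\esum_(b in B) (csq '[x, b])%:E <= (sqn x)%:E)%E.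
Proof.
move=> oB; apply: esum_le_fset => F FB; rewrite lee_fin -subr_ge0.
by rewrite -(@sqn_sub_lcomb B (fun b => '[x, b]) F x) ?sqn_ge0.
Qed.

Lemma lcomb_approx B c y (e : R) : orthonormal_set B ->
  (forall b, B b -> '[y, b] = c b) ->
  \esum_(b in B) (csq (c b))%:E = (sqn y)%:E -> 0 < e ->
  exists2 F : {fset _}, [set` F] `<=` B & sqn (y - lcomb c F) < e.
Proof.
move=> oB yc sy /(esum_approx sy)[F FB sF]; exists F => //.
by rewrite (sqn_sub_lcomb oB) //; [lra|move=> b /FB/yc].
Qed.

(** Finite sets [F n] that capture all but [1 / (n + 1)] of the total give a Cauchy sequence of
    partial sums, whose limit is [y]. *)
Lemma riesz_fischer B c : orthonormal_set B ->
  (\esum_(b in B) (csq (c b))%:E < +oo)%E ->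
  exists2 y, (forall b, B b -> '[y, b] = c b) &
    \esum_(b in B) (csq (c b))%:E = (sqn y)%:E.
Proof.
move=> oB sfin; set s := \esum_(b in B) _ in sfin *.
have s0 : (0 <= s)%E by apply: esum_ge0 => b _; rewrite lee_fin csq_ge0.
have [K sK] : exists K, s = K%:E.
  by exists (fine s); rewrite fineK // ge0_fin_numE.
have SK F : [set` F] `<=` B -> \sum_(b <- F) csq (c b) <= K.
  move=> FB; rewrite -lee_fin -sK; apply: esum_fset_le => // b _.
  exact: csq_ge0.
pose eps n : R := n.+1%:R^-1.
have /choice[F FP] (n : nat) : exists F : {fset _}, [set` F] `<=` B /\
    K - eps n < \sum_(b <- F) csq (c b).
  have n0 : 0 < eps n by rewrite invr_gt0.
  by have [F FB FK] := esum_approx sK n0; exists F.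
have FB n : [set` F n] `<=` B by case: (FP n).
have dF n G : [set` G] `<=` B -> (F n `<=` G)%fset ->
    sqn (lcomb c G - lcomb c (F n)) < eps n.
  move=> GB FG; rewrite (sqn_sub_lcomb oB (FB n)); last first.
    by move=> b bF; rewrite (ip_lcomb _ oB GB (FB n _ bF)) (fsubsetP FG).
  rewrite (sqn_lcomb _ oB GB); have [_ FK] := FP n; have := SK _ GB; lra.
have FUB n m : [set` (F n `|` F m)%fset] `<=` B.
  by move=> b /=; rewrite in_fsetE => /orP[/FB|/FB].
have inv_small (e : R) : 0 < e -> exists N, forall n, (N <= n)%N ->
    eps n < e.
  move=> e0; exists (Num.truncn e^-1) => n Nn.
  rewrite /eps -[ltRHS]invrK ltf_pV2 ?posrE ?invr_gt0 //.
  by apply: lt_le_trans (truncnS_gt _) _; rewrite ler_nat.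
have [|y yP] := @sqn_complete _ _ (fun n => lcomb c (F n)).
  move=> e e0; have [N NP] := inv_small (e / 4) (divr_gt0 e0 (ltr0n _ 4)).
  exists N => n m /NP n1 /NP m1.
  (* Two partial sums are compared through the one over the union, which is close to both. *)
  have := sqnB_le (lcomb c (F n `|` F m)%fset - lcomb c (F m))
    (lcomb c (F n `|` F m)%fset - lcomb c (F n)).
  rewrite opprB addrC addrA subrK.
  have := dF n _ (FUB n m) (fsubsetUl _ _).
  have := dF m _ (FUB n m) (fsubsetUr _ _); lra.
have yb b : B b -> '[y, b] = c b.
  move=> Bb; apply/eqP; rewrite -subr_eq0 -csq_eq0 eq_le csq_ge0 andbT.
  apply/ler_addgt0Pr => e e0; rewrite add0r.
  have e4 := divr_gt0 e0 (ltr0n R 4).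
  have [N1 NP1] := yP _ e4; have [N2 NP2] := inv_small _ e4.
  pose n := maxn N1 N2.
  have := NP1 n (leq_maxl _ _); have := NP2 n (leq_maxr _ _) => nP yn.
  have h1 : csq ('[y, b] - '[lcomb c (F n), b]) <= sqn (lcomb c (F n) - y).
    rewrite -ipBl sqn_subC (le_trans (cauchy_schwarz _ _)) //.
    by rewrite [sqn b]/sqn oB // eqxx mulr1.
  have h2 : csq ('[lcomb c (F n), b] - c b) <= eps n.
    rewrite (ip_lcomb _ oB (FB n)) //; case: ifPn => bF.
      by rewrite subrr csq0 invr_ge0.
    (* If [b] lies outside [F n], adding it shows that [csq (c b)] is at most the mass [eps n] that
       [F n] misses. *)
    rewrite sub0r; have GB : [set` (b |` F n)%fset] `<=` B.
      by move=> a /=; rewrite in_fset1U => /orP[/eqP->|/FB].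
    have [_ FK] := FP n; have := SK _ GB.
    rewrite big_fsetU1 //= csqN; lra.
  have := csqD_le ('[y, b] - '[lcomb c (F n), b]) ('[lcomb c (F n), b] - c b).
  by rewrite addrA subrK; lra.
exists y => //; rewrite sK; congr _%:E; apply/eqP; rewrite eq_le.
apply/andP; split.
  rewrite -lee_fin -sK; apply: le_trans (bessel y oB).
  by apply: le_esum => b Bb; rewrite yb.
apply/ler_addgt0Pr => e e0; have [N NP] := yP _ e0.
have := NP N (leqnn _); rewrite sqn_subC (sqn_sub_lcomb oB (FB N)).
  by have := SK _ (FB N); lra.
by move=> b /FB/yb.
Qed.

(** For an incomplete [B], [y] is the orthogonal projection of [x] onto the closed span of [B]. *)
Lemma fourier_projection B x : orthonormal_set B ->
  exists2 y, (forall b, B b -> '[y, b] = '[x, b]) &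
    \esum_(b in B) (csq '[x, b])%:E = (sqn y)%:E.
Proof.
by move=> oB; apply: riesz_fischer => //;
  exact: le_lt_trans (bessel x oB) (ltry _).
Qed.

Lemma basis_ext B x y : orthonormal_basis B ->
  (forall b, B b -> '[x, b] = '[y, b]) -> x = y.
Proof.
move=> [_ cB] xy; apply/eqP; rewrite -subr_eq0; apply/eqP/cB => b Bb.
by rewrite ipBl xy // subrr.
Qed.

Lemma parseval B x : orthonormal_basis B ->
  \esum_(b in B) (csq '[x, b])%:E = (sqn x)%:E.
Proof.
move=> bB; have [y yx ->] := fourier_projection x bB.1.
by rewrite (basis_ext bB yx).
Qed.

Lemma basis_approx B x (e : R) : orthonormal_basis B -> 0 < e ->
  exists2 F : {fset _}, [set` F] `<=` B & sqn (x - lcomb (fun b => '[x, b]) F) < e.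
Proof.
by move=> bB; apply: (lcomb_approx bB.1) => //; exact: parseval.
Qed.

End Fourier.

(** * The spectral theorem for a sum of forms *)

Section SpectralTheorem.
Variables (R : realType) (H : hilbertType R) (K : eqType).
Variables (T : K -> H -> H) (s : seq K).
Hypothesis lT : forall k, linear (T k).
Hypothesis cT : forall k, seq_compact (T k).
Implicit Types (x y z e : H) (B : set H) (c : R[i]).

Local Notation "'[ x , y ]" := (@inner R H x y).

(** This is the form of [Z = sum_k T_k^* T_k]. Working with the form keeps adjoints out of the
    spectral theorem. *)
Definition gram x y : R[i] := \sum_(k <- s) '[T k x, T k y].
Definition energy x : R := \sum_(k <- s) sqn (T k x).

(** The weak form of [Z e = m e]. *)
Definition gram_eigen (m : R) e := forall x, gram e x = m%:C * '[e, x].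

Lemma gramDl x y z : gram (x + y) z = gram x z + gram y z.
Proof.
by rewrite /gram -big_split; apply: eq_bigr => k _; rewrite (linD _ _ (lT k)) ipDl.
Qed.

Lemma gramC x y : gram y x = (gram x y)^*.
Proof. by rewrite rmorph_sum; apply: eq_bigr => k _; exact: ipC. Qed.

Lemma gramDr x y z : gram z (x + y) = gram z x + gram z y.
Proof. by rewrite gramC gramDl rmorphD /= -!gramC. Qed.

Lemma gramZl c x y : gram (c *: x) y = c * gram x y.
Proof.
by rewrite /gram mulr_sumr; apply: eq_bigr => k _; rewrite (linZ _ _ (lT k)) ipZl.
Qed.

Lemma gramZr c x y : gram x (c *: y) = c^* * gram x y.
Proof. by rewrite gramC gramZl rmorphM /= -gramC. Qed.

Lemma gramNr x y : gram x (- y) = - gram x y.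
Proof. by rewrite -scaleN1r gramZr rmorphN1 mulN1r. Qed.

Lemma gramBr x y z : gram z (x - y) = gram z x - gram z y.
Proof. by rewrite gramDr gramNr. Qed.

Lemma gram0r x : gram x 0 = 0.
Proof. by rewrite -(scale0r 0) gramZr rmorph0 mul0r. Qed.

Lemma gram_suml I (r : seq I) (X : I -> H) y :
  gram (\sum_(i <- r) X i) y = \sum_(i <- r) gram (X i) y.
Proof.
apply: (big_morph (gram^~ y)) => [a b|]; first exact: gramDl.
by rewrite gramC gram0r conjc0.
Qed.

Lemma gramxx x : gram x x = (energy x)%:C.
Proof. by rewrite rmorph_sum; apply: eq_bigr => k _; exact: ipxx. Qed.

Lemma energy_ge0 x : 0 <= energy x.
Proof. by apply: sumr_ge0 => k _; exact: sqn_ge0. Qed.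

Lemma energyD x y : energy (x + y) = energy x + energy y + complex.Re (gram x y) *+ 2.
Proof.
rewrite /energy /gram Re_sum -sumrMnl -!big_split; apply: eq_bigr => k _ /=.
by rewrite (linD _ _ (lT k)) sqnD.
Qed.

Lemma energyZ c x : energy (c *: x) = csq c * energy x.
Proof.
by rewrite /energy mulr_sumr; apply: eq_bigr => k _; rewrite (linZ _ _ (lT k)) sqnZ.
Qed.

Lemma gram_cauchy_schwarz x y : csq (gram x y) <= energy x * energy y.
Proof.
apply: discriminant_le (energy_ge0 _) _ => t.
have := energy_ge0 (x + t^* *: y).
by rewrite energyD gramZr conjcK energyZ csqJ addrAC.
Qed.

Lemma energy_bounded : exists2 C : R, 0 < C & forall x, energy x <= C * sqn x.
Proof.
rewrite /energy; elim: s => [|k s' [C C0 CP]].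
  by exists 1 => // x; rewrite big_nil mul1r sqn_ge0.
have [D D0 DP] := seq_compact_bounded (lT k) (cT k).
exists (D + C) => [|x]; first exact: addr_gt0.
by rewrite big_cons mulrDl lerD.
Qed.

Lemma joint_subsequence (u : nat -> H) : (forall n, sqn (u n) <= 1) ->
  exists2 phi : nat -> nat, (forall n, (n <= phi n)%N) &
    forall k, k \in s -> exists y, sqn_cvg (fun n => T k (u (phi n))) y.
Proof.
move=> u1; elim: s => [|k s' [phi phi_ge phiP]]; first by exists id.
have [psi [y [psi_ge psiP]]] := cT k (fun n => u1 (phi n)).
exists (phi \o psi) => [n|k']; first exact: leq_trans (phi_ge _).
rewrite inE => /orP[/eqP->|/phiP[z zP]]; first by exists y.
by exists z; exact: (sqn_cvg_shift psi_ge zP).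
Qed.

Lemma energy_cauchy (u : nat -> H) : (forall n, sqn (u n) <= 1) ->
  exists2 phi : nat -> nat, (forall n, (n <= phi n)%N) &
    forall d : R, 0 < d -> exists N, forall n m, (N <= n)%N -> (N <= m)%N ->
      energy (u (phi n) - u (phi m)) < d.
Proof.
move=> /joint_subsequence[phi phi_ge phiP]; exists phi => //.
rewrite /energy; elim: s phiP => [|k s' IH] phiP d d0.
  by exists 0%N => n m _ _; rewrite big_nil.
have d2 : 0 < d / 2 by rewrite divr_gt0.
have [|N NP] := IH _ (d / 2) d2.
  by move=> k' k's; apply: phiP; rewrite inE k's orbT.
have [y yP] := phiP k (mem_head _ _).
(* Two vectors within squared distance [d / 8] of [y] are within [2 (d / 8 + d / 8) = d / 2] of each
   other. *)
have [N' NP'] := yP (d / 8) (divr_gt0 d0 (ltr0n _ 8)).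
exists (maxn N N') => n m; rewrite !geq_max => /andP[n1 n2] /andP[m1 m2].
rewrite big_cons (linB _ _ (lT k)).
have := sqnB_le (T k (u (phi n)) - y) (T k (u (phi m)) - y).
rewrite opprB addrA subrK.
have := NP' _ n2; have := NP' _ m2; have := NP _ _ n1 m1; lra.
Qed.

(** * Maximizing the form on the orthogonal complement of a set of eigenvectors *)

Section Maximizer.
Variable B : set H.
Hypothesis oB : orthonormal_set B.
Hypothesis eB : forall b, B b -> exists m, gram_eigen m b.

Let M x := forall b, B b -> '[x, b] = 0.

Let MD x y : M x -> M y -> M (x + y).
Proof. by move=> Mx My b Bb; rewrite ipDl Mx // My // addr0. Qed.

Let MZ c x : M x -> M (c *: x).
Proof. by move=> Mx b Bb; rewrite ipZl Mx // mulr0. Qed.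

Let MB x y : M x -> M y -> M (x - y).
Proof. by move=> Mx My; rewrite -scaleN1r; apply: MD => //; exact: MZ. Qed.

Let M_closed (u : nat -> H) y : (forall n, M (u n)) -> sqn_cvg u y -> M y.
Proof.
move=> Mu uy b Bb; apply/eqP; rewrite -csq_eq0 eq_le csq_ge0 andbT.
apply/ler_addgt0Pr => e e0; have [N NP] := uy _ e0; rewrite add0r.
apply: le_trans (ltW (NP N (leqnn _))).
have <- : '[y - u N, b] = '[y, b] by rewrite ipBl Mu // subr0.
rewrite sqn_subC (le_trans (cauchy_schwarz _ _)) //.
by rewrite [sqn b]/sqn oB // eqxx mulr1.
Qed.

(* With [q x = energy x] and [D x = m |x|^2 - q x] for the supremum [m] of [q]
   on the unit sphere of [M], one has [m |x - y|^2 = q (x - y) + D (x - y)] and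
   [D (x - y) <= 2 D x + 2 D y]. *)
Lemma exists_maximizer x0 : M x0 -> x0 != 0 -> exists (m : R) e,
  [/\ M e, e != 0, energy e = m * sqn e &
      forall x, M x -> energy x <= m * sqn x].
Proof.
move=> Mx0 x00.
pose V := [set energy x | x in [set x | M x /\ sqn x = 1]].
have sqn_gt0 x : x != 0 -> 0 < sqn x.
  by move=> x_n0; rewrite lt_def sqn_eq0 x_n0 sqn_ge0.
have nrmP x : x != 0 -> M x -> exists (a : R) x',
    [/\ M x', sqn x' = 1, x = a%:C *: x' & sqn x = a ^+ 2].
  move=> x_n0 Mx; have sx0 := sqn_gt0 _ x_n0.
  have a0 : (Num.sqrt (sqn x))%:C != 0 :> R[i].
    by rewrite (inj_eq (@complexI R)) sqrtr_eq0 -ltNge.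
  exists (Num.sqrt (sqn x)), ((Num.sqrt (sqn x))^-1%:C *: x); split.
  - exact: MZ.
  - by rewrite sqnZ csqr exprVn sqr_sqrtr ?sqn_ge0 // mulVf ?gt_eqF.
  - by rewrite scalerA fmorphV /= divff // scale1r.
  - by rewrite sqr_sqrtr ?sqn_ge0.
have [C C0 CP] := energy_bounded.
have supV : has_sup V.
  have [a [x1 [Mx1 sx1 _ _]]] := nrmP _ x00 Mx0.
  split; first by exists (energy x1), x1.
  by exists C => _ [x [_ sx] <-]; rewrite (le_trans (CP x)) // sx mulr1.
pose m := sup V.
have mP x : M x -> energy x <= m * sqn x.
  move=> Mx; have [->|x_n0] := eqVneq x 0.
    by rewrite sqn0 mulr0 (le_trans (CP _)) // sqn0 mulr0.
  have [a [x1 [Mx1 sx1 xE ->]]] := nrmP _ x_n0 Mx.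
  rewrite xE energyZ csqr mulrC ler_wpM2r ?sqr_ge0 //.
  by apply: ub_le_sup; [exact: supV.2|exists x1].
pose D x := m * sqn x - energy x.
have D_ge0 x : M x -> 0 <= D x by move=> Mx; rewrite subr_ge0 mP.
have DD x y : D (x + y) = D x + D y + (m * complex.Re '[x, y] - complex.Re (gram x y)) *+ 2.
  by rewrite /D sqnD energyD; ring.
have DN x : D (- x) = D x by rewrite -scaleN1r /D sqnZ energyZ csqN csqr expr1n !mul1r.
have D_le x y : M x -> M y -> D (x - y) <= (D x + D y) *+ 2.
  move=> Mx My; have := D_ge0 _ (MD Mx My).
  by rewrite !DD DN gramNr ipNr !ReN; lra.
have V0 v : V v -> 0 <= v by move=> [x _ <-]; exact: energy_ge0.
have m0 : 0 <= m.
  by have [v Vv] := supV.1; apply: le_trans (V0 _ Vv) _; apply: ub_le_sup (supV.2) _ Vv.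
(* If [m = 0], the energy vanishes on [M] and [x0] is itself a maximizer. *)
have [m_gt0|m_le0] := ltP 0 m; last first.
  exists m, x0; split => //.
  have {m_le0 m0} m_eq0 : m = 0 by apply/eqP; rewrite eq_le m_le0.
  by apply/eqP; rewrite eq_le mP // m_eq0 mul0r energy_ge0.
pose eps n : R := n.+1%:R^-1.
have eps_small (d : R) : 0 < d -> exists N, forall n, (N <= n)%N -> eps n < d.
  move=> d0; exists (Num.truncn d^-1) => n Nn.
  rewrite /eps -[ltRHS]invrK ltf_pV2 ?posrE ?invr_gt0 //.
  by apply: lt_le_trans (truncnS_gt _) _; rewrite ler_nat.
have /choice[u uP] (n : nat) : exists x, [/\ M x, sqn x = 1 & D x < eps n].
  have eps0 : 0 < eps n by rewrite invr_gt0.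
  have [_ [x [Mx sx] <-] xP] := sup_adherent eps0 supV.
  by exists x; split => //; rewrite /D sx mulr1; move: xP; rewrite -/m; lra.
have Mu n : M (u n) by case: (uP n).
have su n : sqn (u n) = 1 by case: (uP n).
have [|phi phi_ge phiP] := @energy_cauchy u; first by move=> n; rewrite su.
have Du (d : R) : 0 < d -> exists N, forall n, (N <= n)%N -> D (u (phi n)) < d.
  move=> /eps_small[N NP]; exists N => n Nn; have [_ _ /lt_trans] := uP (phi n).
  by apply; apply: NP; exact: leq_trans (phi_ge n).
have [|e ue] := @sqn_complete _ _ (u \o phi).
  (* The energy of the difference contributes one fifth of [m * d], and the bound [2 (D x + D y)]
     the other four. *)
  move=> d d0; have md : 0 < m * d / 5 by rewrite divr_gt0 // mulr_gt0.
  have [N1 NP1] := phiP _ md; have [N2 NP2] := Du _ md.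
  exists (maxn N1 N2) => n k; rewrite !geq_max => /andP[n1 n2] /andP[k1 k2].
  rewrite -(ltr_pM2l m_gt0) /=.
  have := D_le _ _ (Mu (phi n)) (Mu (phi k)); rewrite {1}/D.
  have := NP1 _ _ n1 k1; have := NP2 _ n2; have := NP2 _ k2; lra.
have Me : M e by apply: M_closed ue => n; exact: Mu.
exists m, e; split => //.
  apply: contraPneq ue => -> /(_ 1 ltr01)[N /(_ N (leqnn _))].
  by rewrite subr0 /= su ltxx.
apply/eqP; rewrite eq_le mP //= -subr_le0; apply/ler_addgt0Pr => d d0.
rewrite add0r -/(D e).
have d4 : 0 < d / 4 by rewrite divr_gt0.
have [N1 NP1] := Du _ d4.
have [N2 NP2] := ue (d / 4 / m) (divr_gt0 d4 m_gt0).
pose n := maxn N1 N2.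
have := NP1 n (leq_maxl _ _); have := NP2 n (leq_maxr _ _).
rewrite ltr_pdivlMr //= => h2 h1.
(* Since [e = u - (u - e)], [D e <= 2 (D u + D (u - e))], and both terms in the bracket are below
   [d / 4]. *)
have := D_le _ _ (Mu (phi n)) (MB (Mu (phi n)) Me).
rewrite opprB addrC subrK.
have : D (u (phi n) - e) <= m * sqn (u (phi n) - e) by rewrite gerBl energy_ge0.
lra.
Qed.

(** The form [m |x|^2 - energy x] is nonnegative on [M] and vanishes at [e], so its first variation
    [G] vanishes on [M]. It also vanishes on [B], whose eigenvectors are orthogonal to [e], and by
    boundedness on the closed span of [B]. Every vector is a sum of two vectors of these kinds. *)
Lemma maximizer_eigen (m : R) e : M e -> energy e = m * sqn e ->
  (forall x, M x -> energy x <= m * sqn x) -> gram_eigen m e.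
Proof.
move=> Me em mP.
pose G v := m%:C * '[e, v] - gram e v.
suff G0 : forall v, G v = 0 by move=> w; apply/esym/eqP; rewrite -subr_eq0; exact/eqP/G0.
have GM w : M w -> G w = 0.
  move=> Mw; apply/eqP; rewrite -csq_eq0 eq_le csq_ge0 andbT.
  (* The nonnegative quadratic in [t] has constant term [0], so its linear coefficient [G w] must
     vanish. *)
  rewrite -[leRHS](mul0r (m * sqn w - energy w)).
  apply: discriminant_le => [|t]; first by rewrite subr_ge0 mP.
  have := mP _ (MD Me (MZ (t^*) Mw)).
  rewrite -subr_ge0 sqnD energyD sqnZ energyZ csqJ ipZr gramZr conjcK em.
  rewrite /G mulrBr ReB mulrCA Re_realM; lra.
have GB v w : G (v - w) = G v - G w by rewrite /G ipBr gramBr; ring.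
have Glc (c : H -> R[i]) (F : {fset H}) : [set` F] `<=` B -> G (lcomb c F) = 0.
  move=> FB; rewrite /lcomb big_seq; elim/big_rec: _ => [|b v bF Gv].
    by rewrite /G ip0r gram0r mulr0 subrr.
  have Bb := FB _ bF; have [l lP] := eB Bb.
  have -> : c b *: b + v = c b *: b - (0 - v) by rewrite sub0r opprK.
  rewrite GB (GB 0 v) Gv subr0 /G ip0r gram0r mulr0 subrr subr0.
  by rewrite ipZr gramZr gramC lP (ipC e b) Me // conjc0 !mulr0 conjc0 mulr0 subrr.
have [C C0 CP] := energy_bounded.
(* Twice the sum of the Cauchy-Schwarz bounds for the two terms of [G]. *)
pose C' := (m ^+ 2 * sqn e + energy e * C) *+ 2.
have C'0 : 0 <= C'.
  by rewrite mulrn_wge0 // addr_ge0 // mulr_ge0 ?sqr_ge0 ?sqn_ge0 ?energy_ge0 // ltW.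
have Gle w : csq (G w) <= C' * sqn w.
  rewrite /G (le_trans (csqD_le _ _)) // csqN csqM csqr /C' mulrnAl lerMn2r /=.
  rewrite mulrDl lerD //.
    by rewrite -mulrA ler_wpM2l ?sqr_ge0 // cauchy_schwarz.
  by rewrite (le_trans (gram_cauchy_schwarz _ _)) // -mulrA ler_wpM2l ?energy_ge0.
move=> v; have [y yP sy] := fourier_projection v oB.
have -> : v = v - y - (0 - y) by rewrite sub0r opprK subrK.
have M1 : M (v - y) by move=> b Bb; rewrite ipBl yP // subrr.
rewrite GB (GM _ M1) sub0r GB.
have -> : G y = 0; last by rewrite subr0 /G ip0r gram0r mulr0 subrr oppr0.
apply/eqP; rewrite -csq_eq0 eq_le csq_ge0 andbT; apply/ler_addgt0Pr => d d0.
rewrite add0r; have d' : 0 < d / (C' + 1) by rewrite divr_gt0 // ltr_wpDl.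
have [F FB FP] := lcomb_approx oB yP sy d'.
have -> : G y = G (y - lcomb (fun b => '[v, b]) F) by rewrite GB Glc // subr0.
rewrite (le_trans (Gle _)) //; move: FP; rewrite ltr_pdivlMr ?ltr_wpDl // => FP.
rewrite (le_trans _ (ltW FP)) // mulrC ler_wpM2l ?sqn_ge0 //; lra.
Qed.

End Maximizer.

Theorem spectral_gram : exists B (m : H -> R), orthonormal_basis B /\
  forall e, B e -> 0 <= m e /\ gram_eigen (m e) e.
Proof.
pose P B := orthonormal_set B /\ forall b, B b -> exists m, gram_eigen m b.
(* [P] passes to the union of a chain because any two vectors of the union lie in one member of the
   chain. *)
have [|B [[oB eB] maxB]] := @Zorn_bigcup _ P.
  move=> F FP totF; split; last by move=> b [X /FP[_ +] Xb]; exact.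
  move=> e f [X FX Xe] [Y FY Yf].
  have [XY|YX] := totF _ _ FX FY.
    by have [oY _] := FP _ FY; apply: oY => //; exact: XY.
  by have [oX _] := FP _ FX; apply: oX => //; exact: YX.
have /choice[m mP] e : exists m, B e -> gram_eigen m e.
  have [/eB[m mP]|nBe] := pselect (B e); first by exists m.
  by exists 0.
exists B, m; split; last first.
  move=> e Be; split; last exact: mP.
  have := mP _ Be e; rewrite gramxx oB // eqxx mulr1 => /complexI <-.
  exact: energy_ge0.
split=> // x xB; apply: contrapT => /eqP x0.
have [l [e [Me e0 em lmax]]] := exists_maximizer oB xB x0.
have le := maximizer_eigen oB eB Me em lmax.
have se0 : 0 < sqn e by rewrite lt_def sqn_eq0 e0 sqn_ge0.
pose f := (Num.sqrt (sqn e))^-1%:C *: e.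
have ff : '[f, f] = 1.
  by rewrite ipxx sqnZ csqr exprVn sqr_sqrtr ?sqn_ge0 // mulVf ?gt_eqF.
have fB b : B b -> '[f, b] = 0 by move=> Bb; rewrite ipZl Me // mulr0.
have Bf b : B b -> '[b, f] = 0 by move=> Bb; rewrite ipC fB // conjc0.
have nBf : ~ B f by move=> /fB; rewrite ff => /eqP; rewrite oner_eq0.
(* The normalized maximizer [f] strictly enlarges [B], against its maximality. *)
apply: (maxB (B `|` [set f])).
  split; first by move=> b; left.
  by move=> /(_ f) h; apply: nBf; apply: h; right.
split.
  move=> a b [Ba|->] [Bb|->].
  - exact: oB.
  - by rewrite Bf //; case: eqP => // ab; rewrite ab in Ba.
  - by rewrite fB //; case: eqP => // ab; rewrite -ab in Bb.
  - by rewrite ff eqxx.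
move=> b [/eB//|->]; exists l => v.
by rewrite gramZl le ipZl mulrCA.
Qed.

End SpectralTheorem.

(** * Diagonal operators and Schatten norms *)

Section SumLemmas.
Variable R : realType.

Lemma esumZl (T : choiceType) (B : set T) (f : T -> \bar R) (k : R) : 0 <= k ->
  (forall b, B b -> 0 <= f b)%E ->
  (\esum_(b in B) (k%:E * f b) = k%:E * \esum_(b in B) f b)%E.
Proof.
move=> k0 f0; rewrite [in RHS]/esum -ereal_supZl //; last first.
  by apply/set0P; exists (\sum_(x \in set0) f x)%E, set0 => //; exact: fsets_set0.
have sumZ X : fsets B X -> (\sum_(x \in X) (k%:E * f x) = k%:E * \sum_(x \in X) f x)%E.
  move=> [finX XB]; rewrite !fsbig_finite //= !big_seq ge0_sume_distrr // => x.
  by rewrite in_fset_set // => /set_mem/XB/f0.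
congr ereal_sup; apply/seteqP; split=> [_ [X BX <-]|_ [_ [X BX <-] <-]].
  by exists (\sum_(x \in X) f x)%E; [exists X|rewrite sumZ].
by exists X => //; rewrite sumZ.
Qed.

Lemma esum_exchange (T T' : choiceType) (I : set T) (J : set T')
    (a : T -> T' -> \bar R) : (forall i j, I i -> J j -> 0 <= a i j)%E ->
  (\esum_(i in I) \esum_(j in J) a i j = \esum_(j in J) \esum_(i in I) a i j)%E.
Proof.
move=> a0; rewrite !esum_esum //; last by move=> j i Jj Ii; exact: a0.
rewrite (@reindex_esum _ _ _ (J `*`` fun=> I) _ (fun x => (x.2, x.1))) //.
split=> [[j i] [] //|[j i] [j' i'] _ _ [-> ->] //|[i j] [/= Ii Jj]].
by exists (j, i).
Qed.

End SumLemmas.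

Section DiagonalOperators.
Variables (R : realType) (H : hilbertType R).
Implicit Types (x y z u v : H) (A T P : H -> H) (B : set H).

Local Notation "'[ x , y ]" := (@inner R H x y).

(** [f] vanishes on finite combinations of basis vectors, which are dense. *)
Lemma functional_eq0 B (f : H -> R[i]) (C : R) : orthonormal_basis B ->
  linear_for *%R f -> (forall x, csq (f x) <= C * sqn x) ->
  (forall b, B b -> f b = 0) -> forall x, f x = 0.
Proof.
move=> bB lf fC fb x.
have f0 : f 0 = 0.
  by apply/eqP; rewrite -csq_eq0 eq_le csq_ge0 andbT (le_trans (fC 0)) // sqn0 mulr0.
have flc (c : H -> R[i]) (F : {fset H}) : [set` F] `<=` B -> f (lcomb c F) = 0.
  move=> FB; rewrite /lcomb big_seq; elim/big_rec: _ => // b v bF fv.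
  by rewrite lf (fb _ (FB _ bF)) mulr0 add0r.
apply/eqP; rewrite -csq_eq0 eq_le csq_ge0 andbT; apply/ler_addgt0Pr => e e0.
rewrite add0r; have C1 : 0 < `|C| + 1 by rewrite ltr_wpDl.
have [F FB xF] := basis_approx x bB (divr_gt0 e0 C1).
have <- : f (x - lcomb (fun b => '[x, b]) F) = f x.
  by rewrite addrC -scaleN1r lf flc // mulr0 add0r.
rewrite (le_trans (fC _)) //; move: xF; rewrite ltr_pdivlMr // => xF.
rewrite (le_trans _ (ltW xF)) // mulrC ler_wpM2l ?sqn_ge0 //.
by rewrite (le_trans (ler_norm C)) // lerDl.
Qed.

Lemma bounded_comp_functional A y : linear A -> sqn_bounded A ->
  linear_for *%R (fun x => '[A x, y]) /\
  exists C, forall x, csq '[A x, y] <= C * sqn x.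
Proof.
move=> lA [C C0 CP]; split=> [c x z|]; first by rewrite lA ipDl ipZl.
exists (C * sqn y) => x; rewrite (le_trans (cauchy_schwarz _ _)) //.
by rewrite mulrAC ler_wpM2r ?sqn_ge0.
Qed.

Lemma functional_ext B (f g : H -> R[i]) (C D : R) : orthonormal_basis B ->
  linear_for *%R f -> (forall x, csq (f x) <= C * sqn x) ->
  linear_for *%R g -> (forall x, csq (g x) <= D * sqn x) ->
  (forall b, B b -> f b = g b) -> forall x, f x = g x.
Proof.
move=> bB lf fC lg gD fg x; apply/eqP; rewrite -subr_eq0; apply/eqP.
apply: (@functional_eq0 B (fun x => f x - g x) ((C + D) *+ 2)) => //.
- by move=> c y z; rewrite lf lg; ring.
- move=> y; rewrite (le_trans (csqD_le _ _)) // csqN mulrnAl lerMn2r /=.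
  by rewrite mulrDl lerD.
- by move=> b Bb; rewrite fg // subrr.
Qed.

Lemma inner_functional y : linear_for *%R (fun x => '[x, y]) /\
  forall x, csq '[x, y] <= sqn y * sqn x.
Proof.
split=> [c x z|x]; first by rewrite ipDl ipZl.
by rewrite mulrC cauchy_schwarz.
Qed.

(** [adjoint] is selected by [xget], so a witness has to be built: its value at [y] is the
    Riesz-Fischer vector with coefficients [<y, A b>]. *)
Lemma adjointP B A : orthonormal_basis B -> linear A -> sqn_bounded A ->
  forall x y, '[A x, y] = '[x, adjoint A y].
Proof.
move=> bB lA bA; suff /choice[A' A'P] y : exists z, forall x, '[A x, y] = '[x, z].
  pose Adj := [set A' : H -> H | forall x y, '[A x, y] = '[x, A' y]].
  have exA : exists A', Adj A' by exists A' => x y.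
  exact: (xgetPex 0 exA).
have [C C0 CP] := bA.
pose c b := '[y, A b].
have [|z zc _] := @riesz_fischer _ _ B c bB.1.
  apply: (@le_lt_trans _ _ (C * sqn y)%:E); last exact: ltry.
  apply: esum_le_fset => F FB; rewrite lee_fin.
  set S := \sum_(b <- F) _.
  have S0 : 0 <= S by apply: sumr_ge0 => b _; exact: csq_ge0.
  (* For [v = lcomb c F], [<y, A v> = S] and [|v|^2 = S], so Cauchy-Schwarz gives
     [S^2 <= C |y|^2 S], a bound on [S] uniform in [F]. *)
  have Sv : sqn (lcomb c F) = S by rewrite (sqn_lcomb _ bB.1 FB).
  have yAv : '[y, A (lcomb c F)] = S%:C.
    rewrite (lin_sum _ _ _ lA) ip_sumr rmorph_sum /=; apply: eq_bigr => b _.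
    by rewrite (linZ _ _ lA) ipZr csqE mulrC.
  have := cauchy_schwarz y (A (lcomb c F)); rewrite yAv csqr => h.
  have : S ^+ 2 <= sqn y * (C * S).
    by rewrite (le_trans h) // ler_wpM2l ?sqn_ge0 // -Sv.
  have [->|Sn0] := eqVneq S 0; first by rewrite mulr_ge0 ?sqn_ge0 // ltW.
  by rewrite expr2 mulrA ler_pM2r ?lt_def ?Sn0 // mulrC.
exists z => x.
have [lf [D fD]] := bounded_comp_functional y lA bA.
have [lg gD] := inner_functional z.
apply: (functional_ext bB lf fD lg gD) => b Bb.
by rewrite (ipC z b) zc // [LHS]ipC.
Qed.

(** Both sides are bounded linear functionals of [x] that agree on the basis. This takes the place
    of self-adjointness of [T]. *)
Lemma diagonal_coef B T (l : H -> R) : orthonormal_basis B -> linear T ->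
  sqn_bounded T -> (forall b, B b -> T b = (l b)%:C *: b) ->
  forall x b, B b -> '[T x, b] = (l b)%:C * '[x, b].
Proof.
move=> bB lT bT Tl x b Bb.
have [lf [C fC]] := bounded_comp_functional b lT bT.
pose g x := (l b)%:C * '[x, b].
have lg : linear_for *%R g by move=> c y z; rewrite /g ipDl ipZl; ring.
have gD y : csq (g y) <= l b ^+ 2 * sqn b * sqn y.
  by rewrite /g csqM csqr -mulrA ler_wpM2l ?sqr_ge0 // mulrC cauchy_schwarz.
apply: (functional_ext bB lf fC lg gD) => a Ba.
rewrite /g Tl // ipZl bB.1 //; case: eqP => [->//|_].
by rewrite !mulr0.
Qed.

Lemma diagonal_operator_exists B (l : H -> R) (C : R) : orthonormal_basis B ->
  (forall b, B b -> 0 <= l b <= C) ->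
  exists2 T, bounded_operator T & forall b, B b -> T b = (l b)%:C *: b.
Proof.
move=> bB lC.
have sum_le x : (\esum_(b in B) (csq ((l b)%:C * '[x, b]))%:E <= (C ^+ 2 * sqn x)%:E)%E.
  rewrite EFinM -(parseval x bB) -esumZl ?sqr_ge0 //; last first.
    by move=> b _; rewrite lee_fin csq_ge0.
  apply: le_esum => b /lC/andP[l0 lb]; rewrite -EFinM lee_fin csqM csqr.
  by rewrite ler_wpM2r ?csq_ge0 // lerXn2r // nnegrE (le_trans l0).
have /choice[T TP] x : exists y, (forall b, B b -> '[y, b] = (l b)%:C * '[x, b]) /\
    sqn y <= C ^+ 2 * sqn x.
  have [|y yP ys] := @riesz_fischer _ _ B (fun b => (l b)%:C * '[x, b]) bB.1.
    by apply: le_lt_trans (sum_le x) _; exact: ltry.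
  by exists y; split => //; rewrite -lee_fin -ys; exact: sum_le.
exists T.
  apply: sqn_bounded_operator.
    move=> c x y; apply: (basis_ext bB) => b Bb; have [+ _] := TP (c *: x + y).
    move=> ->//; rewrite ipDl ipZl [in RHS]ipDl ipZl.
    have [-> // _] := TP x; have [-> // _] := TP y; ring.
  exists (C ^+ 2 + 1) => [|x]; first by rewrite ltr_wpDl ?sqr_ge0.
  by have [_ /le_trans] := TP x; apply; rewrite ler_wpM2r ?sqn_ge0 // lerDl.
move=> b Bb; apply: (basis_ext bB) => a Ba; have [-> // _] := TP b.
rewrite ipZl bB.1 //; case: eqP => [->//|_]; by rewrite !mulr0.
Qed.

(* Polarization reduces this to Parseval's identity for [x + u] and [x - u],
   whose coefficients are [1 + l b] and [1 - l b] times those of [x]. *)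
Lemma weighted_parseval B x u (l : H -> R) : orthonormal_basis B ->
  (forall b, B b -> 0 <= l b) ->
  (forall b, B b -> '[u, b] = (l b)%:C * '[x, b]) ->
  \esum_(b in B) (l b * csq '[x, b])%:E = (complex.Re '[u, x])%:E.
Proof.
move=> bB l0 ul; set E := \esum_(b in B) _.
(* The identity is kept as a sum because [E] could still be infinite; the finite left side then
   rules this out. *)
have : (sqn (x + u))%:E = ((sqn (x - u))%:E + 4%:E * E)%E.
  rewrite -!(parseval _ bB) -esumZl //; last first.
    by move=> b Bb; rewrite lee_fin mulr_ge0 ?csq_ge0 ?l0.
  rewrite -esumD => [|b _|b Bb]; last 2 first.
  - by rewrite lee_fin csq_ge0.
  - by rewrite mule_ge0 ?lee_fin // mulr_ge0 ?csq_ge0 ?l0.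
  apply: eq_esum => b Bb; rewrite -EFinM -EFinD ipDl ipBl ul //.
  rewrite -[X in csq (X + _)]mul1r -[X in csq (X - _)]mul1r -mulrDl -mulrBl.
  by rewrite -rmorphD -rmorphB /= !csqM !csqr; congr _%:E; ring.
have E0 : (0 <= E)%E.
  by apply: esum_ge0 => b Bb; rewrite lee_fin mulr_ge0 ?csq_ge0 ?l0.
case: E E0 => [E _|_|] //; last by rewrite mulry gtr0_sg // mul1e.
rewrite -EFinM -EFinD => -[]; rewrite sqnD sqnB (Re_ipC u x) => h.
congr _%:E; lra.
Qed.

(** [trace] sums over an unspecified basis. In the double sum of [l b |<e, b>|^2], summing over [b]
    first gives the trace, and over [e] first, by Parseval, the sum of the [l b]. *)
Lemma trace_diagonal B T (l : H -> R) : orthonormal_basis B ->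
  bounded_operator T ->
  (forall b, B b -> 0 <= l b /\ T b = (l b)%:C *: b) ->
  trace T = \esum_(b in B) (l b)%:E.
Proof.
move=> bB bT Tl; rewrite /trace; set B0 := xget _ _.
have bB0 : orthonormal_basis B0 by apply: xgetPex; exists B.
have l0 b : B b -> 0 <= l b by case/Tl.
transitivity (\esum_(e in B0) \esum_(b in B) (l b * csq '[e, b])%:E).
  apply: eq_esum => e Be; rewrite (@weighted_parseval B e (T e)) // => b Bb.
  apply: (diagonal_coef bB bT.1 (bounded_operator_sqn bT)) => // a Ba.
  by case: (Tl a Ba).
rewrite esum_exchange => [|e b _ Bb]; last by rewrite lee_fin mulr_ge0 ?csq_ge0 ?l0.
apply: eq_esum => b Bb; under eq_esum do rewrite EFinM ipC csqJ.
rewrite esumZl ?l0 //; last by move=> e _; rewrite lee_fin csq_ge0.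
rewrite (parseval _ bB0) -EFinM.
by rewrite [sqn b]/sqn bB.1 // eqxx mulr1.
Qed.

(** [operator_power] defaults to [0] unless a power exists, and one is built in the basis [B]. The
    selected power may come with another basis. *)
Lemma operator_powerP B P (l : H -> R) (C s : R) : 0 <= s ->
  orthonormal_basis B -> (forall b, B b -> 0 <= l b <= C) ->
  (forall b, B b -> P b = (l b)%:C *: b) ->
  is_operator_power P s (operator_power P s).
Proof.
move=> s0 bB lC Pl; apply: xgetPex.
have [|T bT Tl] := @diagonal_operator_exists B (fun b => l b `^ s) (C `^ s) bB.
  move=> b /lC/andP[lb0 lbC]; rewrite powR_ge0 /= ge0_ler_powR // nnegrE //.
  exact: le_trans lbC.
exists T; split=> //; exists B, l; split=> // b Bb; split; last exact: Tl.
  by case/andP: (lC b Bb).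
exact: Pl.
Qed.

(** An orthonormal basis of right singular vectors, kernel vectors included; the second clause is
    the weak form of [A^* A e = mu^2 e]. *)
Definition singular_system A B (mu : H -> R) := orthonormal_basis B /\
  forall e, B e -> 0 <= mu e /\ forall x, '[A e, A x] = (mu e ^+ 2)%:C * '[e, x].

(** Three bases occur: [B] diagonalizes [A^* A] and yields its square root, [B1] comes with the
    selected root [|A|], and [B2] with the selected power [|A|^p]. The trace is read off in [B2],
    whose vectors must therefore be shown to be singular vectors. *)
Lemma schatten_norm_singular (p : R) A : 0 < p -> linear A -> seq_compact A ->
  exists B mu, singular_system A B mu /\
    (schatten_norm p A `^ p = \esum_(e in B) (mu e `^ p)%:E)%E.
Proof.
move=> p0 lA cA; have bA := seq_compact_bounded lA cA; have [C C0 CP] := bA.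
have [B [m [bB Bm]]] := @spectral_gram _ _ _ (fun _ : unit => A) [:: tt]
  (fun=> lA) (fun=> cA).
have AE e x : B e -> '[A e, A x] = (m e)%:C * '[e, x].
  by case/Bm => _ /(_ x); rewrite /gram big_seq1.
have AP := adjointP bB lA bA.
pose P := adjoint A \o A.
have Pm e : B e -> P e = (m e)%:C *: e.
  move=> Be; apply: (basis_ext bB) => b _.
  by rewrite ipZl -AE // [LHS]ipC -AP -ipC.
have mC e : B e -> 0 <= m e <= C.
  move=> Be; have [-> _] := Bm e Be; rewrite /= -lecR.
  have := AE e e Be; rewrite ipxx bB.1 // eqxx mulr1 => <-.
  by rewrite lecR (le_trans (CP e)) // [sqn e]/sqn bB.1 // eqxx mulr1.
have s2 : 0 <= 2^-1 :> R by rewrite invr_ge0.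
have [bT1 [B1 [l1 [bB1 Bl1]]]] := operator_powerP s2 bB mC Pm.
set T1 := operator_power P 2^-1 in bT1 Bl1.
have bT1' := bounded_operator_sqn bT1; have [C1 C10 C1P] := bT1'.
have T1l b : B1 b -> T1 b = (l1 b `^ 2^-1)%:C *: b by case/Bl1.
(* The next power needs bounded eigenvalues; those of the root are bounded because the root is a
   bounded operator. *)
have l1C b : B1 b -> 0 <= l1 b `^ 2^-1 <= Num.sqrt C1.
  move=> Bb; rewrite powR_ge0 /= -[leLHS]ger0_norm ?powR_ge0 // -sqrtr_sqr.
  have b1 : sqn b = 1 by rewrite /sqn bB1.1 // eqxx.
  have E : sqn (T1 b) = (l1 b `^ 2^-1) ^+ 2 by rewrite T1l // sqnZ csqr b1 mulr1.
  by rewrite ler_sqrt ?(ltW C10) // -E (le_trans (C1P b)) // b1 mulr1.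
have [bT2 [B2 [mu [bB2 Bmu]]]] := operator_powerP (ltW p0) bB1 l1C T1l.
exists B2, mu; split.
  split=> // e Be; have [mu0 T1e _] := Bmu _ Be; split=> // x.
  have [lf [D fD]] := bounded_comp_functional (A e) lA bA.
  have [lg gD] := inner_functional e.
  pose g x := (mu e ^+ 2)%:C * '[x, e].
  have lg' : linear_for *%R g by move=> c y z; rewrite /g lg; ring.
  have gD' y : csq (g y) <= (mu e ^+ 2) ^+ 2 * sqn e * sqn y.
    by rewrite /g csqM csqr -mulrA ler_wpM2l ?sqr_ge0.
  rewrite ipC (ipC x e) -[(mu e ^+ 2)%:C]conjc_real -rmorphM; congr (_^*).
  apply: (functional_ext bB1 lf fD lg' gD') => b Bb.
  have [l10 Pb _] := Bl1 _ Bb.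
  have l1E : l1 b = l1 b `^ 2^-1 * l1 b `^ 2^-1.
    by rewrite -expr2 -powR_mulrn ?powR_ge0 // -powRrM mulVf // powRr1.
  (* [|A| e = mu e] gives [l1^(1/2) <e, b> = mu <e, b>], and using this twice,
     [l1 <e, b> = mu^2 <e, b>]. *)
  have := diagonal_coef bB1 bT1.1 bT1' T1l e Bb; rewrite T1e ipZl => h.
  rewrite /g (ipC (A e)) (ipC e) AP [adjoint A (A b)]Pb ipZr conjc_real.
  rewrite -[(mu e ^+ 2)%:C]conjc_real -rmorphM; congr (_^*).
  by rewrite {1}l1E rmorphM /= -mulrA -h mulrCA -h mulrA -rmorphM.
have := trace_diagonal (l := fun b => mu b `^ p) bB2 bT2.
rewrite /schatten_norm -poweRrM mulVf ?gt_eqF // => ->.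
  by rewrite poweRe1 //; apply: esum_ge0 => b _; rewrite lee_fin powR_ge0.
by move=> b Bb; have [_ _ ->] := Bmu _ Bb; rewrite powR_ge0.
Qed.

End DiagonalOperators.

(** * Jensen's inequality for sums with weights *)

Section Jensen.
Variable R : realType.
Implicit Types (q a z : R) (d : bool) (x y : \bar R).

(* [true] stands for the convex case [1 <= q], [false] for the concave one. *)
Definition le_dir d x y := (if d then x <= y else y <= x)%E.

Lemma le_dir_trans d x y (u : \bar R) : le_dir d x y -> le_dir d y u -> le_dir d x u.
Proof. by case: d => /= h1 h2; [exact: le_trans h2|exact: le_trans h1]. Qed.

Lemma le_dir_esum d (T : choiceType) (I : set T) (f g : T -> \bar R) :
  (forall i, I i -> le_dir d (f i) (g i)) ->
  le_dir d (\esum_(i in I) f i) (\esum_(i in I) g i).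
Proof. by case: d => /= fg; exact: le_esum. Qed.

Lemma le_dir_sum d (T : Type) (r : seq T) (P : pred T) (f g : T -> \bar R) :
  (forall i, P i -> le_dir d (f i) (g i)) ->
  le_dir d (\sum_(i <- r | P i) f i)%E (\sum_(i <- r | P i) g i)%E.
Proof. by case: d => /= fg; exact: lee_sum. Qed.

(** Young's inequality for the conjugate exponents [1 / t] and [1 / (1 - t)]. *)
Lemma weighted_am_gm t a z : 0 < t < 1 -> 0 <= a -> 0 <= z ->
  z `^ t * a `^ (1 - t) <= t * z + (1 - t) * a.
Proof.
move=> /andP[t0 t1] a0 z0; have t1' : 0 < 1 - t by rewrite subr_gt0.
have := @conjugate_powR R (z `^ t) (a `^ (1 - t)) t^-1 (1 - t)^-1.
rewrite !powR_ge0 !invr_gt0 t0 t1' !invrK addrC subrK -!powRrM.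
rewrite !divff ?gt_eqF // !powRr1 // [t * z]mulrC [(1 - t) * a]mulrC.
by apply.
Qed.

(** The tangent of [t^q] at [a], obtained from weighted AM-GM for [z^q] and [a^q] with weight
    [1 / q]. *)
Lemma tangent_ge1 q a z : 1 <= q -> 0 < a -> 0 <= z ->
  q * a `^ (q - 1) * z <= z `^ q + (q - 1) * a `^ q.
Proof.
rewrite le_eqVlt => /predU1P[<- a0 z0|q1 a0 z0].
  by rewrite subrr powRr0 powRr1 // !mul1r mul0r addr0.
have q0 : 0 < q by rewrite (lt_trans ltr01).
have t01 : 0 < q^-1 < 1 by rewrite invr_gt0 q0 invf_lt1.
have := weighted_am_gm t01 (powR_ge0 a q) (powR_ge0 z q).
rewrite -!powRrM divff ?gt_eqF // powRr1 //.
have -> : q * (1 - q^-1) = q - 1 by field; rewrite gt_eqF.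
rewrite -(ler_pM2l q0); set X := a `^ (q - 1) => h.
have := h; have -> : q * (q^-1 * z `^ q + (1 - q^-1) * a `^ q) =
  z `^ q + (q - 1) * a `^ q by field; rewrite gt_eqF.
by rewrite [z * _]mulrC mulrA.
Qed.

(** Weighted AM-GM with weight [q], divided by [a^(1 - q)]. *)
Lemma tangent_le1 q a z : 0 < q -> q <= 1 -> 0 < a -> 0 <= z ->
  z `^ q <= q * a `^ (q - 1) * z + (1 - q) * a `^ q.
Proof.
move=> q0; rewrite le_eqVlt => /predU1P[-> a0 z0|q1 a0 z0].
  by rewrite subrr powRr0 powRr1 // !mul1r mul0r addr0.
have t01 : 0 < q < 1 by rewrite q0.
have := weighted_am_gm t01 (ltW a0) z0.
have aq : 0 < a `^ (1 - q) by rewrite powR_gt0.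
rewrite -ler_pdivlMr // => /le_trans; apply.
rewrite le_eqVlt; apply/orP; left; apply/eqP.
have an0 : a != 0 by rewrite gt_eqF.
have E : a `^ q = a * a `^ (q - 1).
  by rewrite -{2}(powRr1 (ltW a0)) -powRD ?an0 ?implybT // addrC subrK.
by rewrite E -(opprB 1 q) powRN; field; rewrite gt_eqF.
Qed.

Definition exponent_range d q := if d then 1 <= q else (0 < q <= 1).

Lemma exponent_range_gt0 d q : exponent_range d q -> 0 < q.
Proof. by case: d => /= [/(lt_le_trans ltr01)|/andP[]]. Qed.

(** The tangent inequalities at the mean [a] are summed with the weights, whose total is [W]. The
    missing mass leaves the term [(q - 1) a^q (1 - W)], whose sign is favourable in both
    directions. *)
Lemma jensen d q (T : choiceType) (J : set T) (w b : T -> R) a :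
  exponent_range d q -> (forall j, J j -> 0 <= w j /\ 0 <= b j) ->
  (\esum_(j in J) (w j)%:E <= 1)%E ->
  \esum_(j in J) (w j * b j)%:E = a%:E ->
  le_dir d (a `^ q)%:E (\esum_(j in J) (w j * b j `^ q)%:E).
Proof.
move=> dq wb w1 wba; have q0 := exponent_range_gt0 dq.
have nonneg (f g : T -> R) : (forall j, J j -> 0 <= f j) ->
    (forall j, J j -> 0 <= g j) -> forall j, J j -> (0 <= (f j * g j)%:E)%E.
  by move=> f0 g0 j Jj; rewrite lee_fin mulr_ge0 ?f0 ?g0.
have w0 j : J j -> 0 <= w j by case/wb.
have b0 j : J j -> 0 <= b j by case/wb.
have a0 : 0 <= a by rewrite -lee_fin -wba; apply: esum_ge0; exact: nonneg.
(* The tangent needs [a > 0]. For [a = 0] in the concave case, every [w j * b j] vanishes, hence so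
   does every [w j * b j^q]. *)
have [a_eq0|a_neq0] := eqVneq a 0.
  rewrite a_eq0 powR0 ?gt_eqF //; case: (d) => /=.
    by apply: esum_ge0; apply: nonneg => // j _; exact: powR_ge0.
  rewrite esum1 // => j Jj; congr _%:E.
  have : (w j * b j)%:E = 0%E.
    apply/eqP; rewrite eq_le (nonneg _ _ w0 b0) // andbT.
    have -> : 0%E = a%:E :> \bar R by rewrite a_eq0.
    rewrite -wba.
    have := @esum_fset_le _ _ J (fun j => w j * b j) [fset j]%fset.
    rewrite big_seq_fset1; apply=> [i Ji|i /=]; first by rewrite -lee_fin nonneg.
    by rewrite in_fset1 => /eqP ->.
  by case => /eqP; rewrite mulf_eq0 => /orP[] /eqP ->; rewrite ?mul0r ?powR0 ?mulr0 ?gt_eqF.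
have {a_neq0}a_gt0 : 0 < a by rewrite lt_def a_neq0.
have [W wW] : exists W, \esum_(j in J) (w j)%:E = W%:E.
  exists (fine (\esum_(j in J) (w j)%:E)); rewrite fineK // ge0_fin_numE.
    by rewrite (le_lt_trans w1) // ltry.
  by apply: esum_ge0 => j /w0; rewrite lee_fin.
have W1 : W <= 1 by rewrite -lee_fin -wW.
have aq : a `^ (q - 1) * a = a `^ q.
  by rewrite -{2}(powRr1 a0) -powRD ?gt_eqF ?implybT // subrK.
case: d dq => /= [q1|/andP[_ q1]].
  have : (\esum_(j in J) ((q * a `^ (q - 1))%:E * (w j * b j)%:E) <=
      \esum_(j in J) ((w j * b j `^ q)%:E + ((q - 1) * a `^ q)%:E * (w j)%:E))%E.
    apply: le_esum => j Jj; rewrite -!EFinM -EFinD lee_fin.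
    have := tangent_ge1 q1 a_gt0 (b0 _ Jj).
    by move=> /(ler_wpM2l (w0 _ Jj)); nra.
  rewrite esumZl ?mulr_ge0 ?powR_ge0 ?(ltW q0) //; last exact: nonneg.
  rewrite esumD; last 2 first.
  - by apply: nonneg => // j _; exact: powR_ge0.
  - by move=> j Jj; rewrite -EFinM lee_fin !mulr_ge0 ?powR_ge0 ?w0 ?subr_ge0.
  rewrite esumZl ?mulr_ge0 ?powR_ge0 ?subr_ge0 // wba wW -!EFinM -mulrA aq.
  rewrite addeC -leeBlDl // -EFinB; apply: le_trans; rewrite lee_fin.
  have q1' : 0 <= q - 1 by rewrite subr_ge0.
  have W1' : 0 <= 1 - W by rewrite subr_ge0.
  by have := mulr_ge0 (mulr_ge0 q1' (powR_ge0 a q)) W1'; lra.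
have : (\esum_(j in J) (w j * b j `^ q)%:E <=
    \esum_(j in J) ((q * a `^ (q - 1))%:E * (w j * b j)%:E + ((1 - q) * a `^ q)%:E * (w j)%:E))%E.
  apply: le_esum => j Jj; rewrite -!EFinM -EFinD lee_fin.
  have := tangent_le1 q0 q1 a_gt0 (b0 _ Jj).
  by move=> /(ler_wpM2l (w0 _ Jj)); nra.
rewrite esumD; last 2 first.
- by move=> j Jj; rewrite -EFinM lee_fin !mulr_ge0 ?powR_ge0 ?w0 ?b0 ?(ltW q0).
- by move=> j Jj; rewrite -EFinM lee_fin !mulr_ge0 ?powR_ge0 ?w0 ?subr_ge0.
rewrite esumZl ?mulr_ge0 ?powR_ge0 ?(ltW q0) //; last exact: nonneg.
rewrite esumZl ?mulr_ge0 ?powR_ge0 ?subr_ge0 // wba wW -!EFinM -EFinD -mulrA aq.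
move=> /le_trans; apply; rewrite lee_fin.
have q1' : 0 <= 1 - q by rewrite subr_ge0.
have W1' : 0 <= 1 - W by rewrite subr_ge0.
by have := mulr_ge0 (mulr_ge0 q1' (powR_ge0 a q)) W1'; lra.
Qed.

(** Jensen in each row, followed by an exchange of sums that leaves the column totals [c]. It serves
    both for the pinching weights and for the weights [|<e, g>|^2]. *)
Lemma transport d q (T1 T2 : choiceType) (I : set T1) (J : set T2)
    (w : T1 -> T2 -> R) (a : T1 -> R) (b c : T2 -> R) :
  exponent_range d q ->
  (forall i j, I i -> J j -> 0 <= w i j) -> (forall j, J j -> 0 <= b j) ->
  (forall i, I i -> \esum_(j in J) (w i j)%:E <= 1)%E ->
  (forall i, I i -> \esum_(j in J) (w i j * b j)%:E = (a i)%:E) ->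
  (forall j, J j -> \esum_(i in I) (w i j)%:E = (c j)%:E) ->
  le_dir d (\esum_(i in I) (a i `^ q)%:E) (\esum_(j in J) (b j `^ q * c j)%:E).
Proof.
move=> dq w0 b0 row wb col.
apply: (@le_dir_trans _ _ (\esum_(i in I) \esum_(j in J) (w i j * b j `^ q)%:E)).
  apply: le_dir_esum => i Ii; apply: jensen => //; [|exact: row|exact: wb].
  by move=> j Jj; rewrite w0 // b0.
rewrite esum_exchange => [|i j Ii Jj]; last first.
  by rewrite lee_fin mulr_ge0 ?powR_ge0 ?w0.
suff -> : \esum_(j in J) \esum_(i in I) (w i j * b j `^ q)%:E =
    \esum_(j in J) (b j `^ q * c j)%:E by rewrite /le_dir lexx if_same.
apply: eq_esum => j Jj; rewrite EFinM -col // -esumZl ?powR_ge0 //; last first.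
  by move=> i Ii; rewrite lee_fin w0.
by apply: eq_esum => i Ii; rewrite -EFinM mulrC.
Qed.

End Jensen.

(** * Comparison of traces *)

Lemma esum_finType (R : realType) (I : finType) (f : I -> \bar R) :
  (forall i, 0 <= f i)%E -> \esum_(i in [set: I]) f i = (\sum_i f i)%E.
Proof.
move=> f0; have finI : finite_set [set: I] by exact: finite_finset.
rewrite esum_fset // fsbig_finite //=; apply: perm_big.
apply: uniq_perm; rewrite ?fset_uniq ?index_enum_uniq // => i.
by rewrite in_fset_set // mem_index_enum; exact: mem_set.
Qed.

Section CompactCombinations.
Variables (R : realType) (H : hilbertType R).
Implicit Types (x y z : H) (A B : H -> H).

Lemma seq_compactD A B : seq_compact A -> seq_compact B ->
  seq_compact (fun x => A x + B x).
Proof.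
move=> cA cB u u1; have [phi [y [phi_ge yP]]] := cA u u1.
have [psi [z [psi_ge zP]]] := cB _ (fun n => u1 (phi n)).
exists (phi \o psi), (y + z); split=> [n|e e0].
  exact: leq_trans (phi_ge _).
have e4 : 0 < e / 4 by rewrite divr_gt0.
have [N1 NP1] := sqn_cvg_shift psi_ge yP e4; have [N2 NP2] := zP _ e4.
exists (maxn N1 N2) => n; rewrite geq_max => /andP[n1 n2].
have := NP1 _ n1; have := NP2 _ n2; rewrite /= opprD addrACA.
have := sqnD_le (A (u (phi (psi n))) - y) (B (u (phi (psi n))) - z); lra.
Qed.

Lemma seq_compactZ (c : R[i]) A : seq_compact A -> seq_compact (fun x => c *: A x).
Proof.
move=> cA u u1; have [phi [y [phi_ge yP]]] := cA u u1.
exists phi, (c *: y); split=> // e e0.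
have c1 : 0 < csq c + 1 by rewrite ltr_wpDl ?csq_ge0.
have [N NP] := yP _ (divr_gt0 e0 c1); exists N => n /NP.
rewrite -scalerBr sqnZ ltr_pdivlMr // => h; apply: le_lt_trans h.
by rewrite mulrC ler_wpM2l ?sqn_ge0 // lerDl.
Qed.

Lemma seq_compact_sum (I : Type) (s : seq I) (A : I -> H -> H) :
  (forall i, seq_compact (A i)) -> seq_compact (fun x => \sum_(i <- s) A i x).
Proof.
move=> cA; elim: s => [|i s IH] u u1.
  exists id, 0; split=> // e e0; exists 0%N => n _.
  by rewrite big_nil subr0 sqn0.
have [phi [y [phi_ge yP]]] := seq_compactD (cA i) IH u1.
exists phi, y; split=> // e /yP[N NP]; exists N => n /NP.
by rewrite big_cons.
Qed.

End CompactCombinations.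

Section CoreInequality.
Variables (R : realType) (H : hilbertType R).
Local Notation "'[ x , y ]" := (@inner R H x y).

(** Weighted Parseval for [A^* A], which is diagonal in [B] with eigenvalues [mu^2]. *)
Lemma singular_energy A B mu : linear A -> seq_compact A ->
  @singular_system R H A B mu ->
  forall x, \esum_(g in B) (mu g ^+ 2 * csq '[x, g])%:E = (sqn (A x))%:E.
Proof.
move=> lA cA [bB Bmu] x; have AP := adjointP bB lA (seq_compact_bounded lA cA).
rewrite (@weighted_parseval _ _ B x (adjoint A (A x))) //.
- by rewrite -Re_ipC -AP.
- by move=> g _; exact: sqr_ge0.
move=> g Bg; have [_ mug] := Bmu _ Bg.
by rewrite ipC -AP mug conj_realM -ipC.
Qed.

Variables (K : choiceType) (S : K -> H -> H) (ks : seq K) (n : nat)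
  (A : 'I_n -> H -> H) (r : 'I_n -> R).
Hypothesis lS : forall k, linear (S k).
Hypothesis cS : forall k, seq_compact (S k).
Hypothesis lA : forall i, linear (A i).
Hypothesis cA : forall i, seq_compact (A i).
Hypothesis r_gt0 : forall i, 0 < r i.
Hypothesis r_sum : \sum_(i < n) (r i)^-1 = 1.
Hypothesis energyE : forall x, energy S ks x = \sum_(i < n) r i * sqn (A i x).

Variables (F : K -> set H) (nu : K -> H -> R) (G : 'I_n -> set H) (mu : 'I_n -> H -> R).
Hypothesis FP : forall k, singular_system (S k) (F k) (nu k).
Hypothesis GP : forall i, singular_system (A i) (G i) (mu i).

Section Eigenbasis.
Variables (E : set H) (z : H -> R).
Hypothesis bE : orthonormal_basis E.
Hypothesis zP : forall e, E e -> 0 <= z e /\ gram_eigen S ks (z e) e.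

Let z0 e : E e -> 0 <= z e. Proof. by case/zP. Qed.

Let sqn_le_energy k x : k \in ks -> sqn (S k x) <= energy S ks x.
Proof.
move=> kks; rewrite /energy (big_rem k) //= lerDl.
by apply: sumr_ge0 => k' _; exact: sqn_ge0.
Qed.

Let energy_E e : E e -> energy S ks e = z e.
Proof.
move=> Ee; have [_ /(_ e)] := zP Ee.
by rewrite gramxx ipxx [sqn e]/sqn bE.1 // eqxx mulr1 => /complexI.
Qed.

Let energy_lcomb (c : H -> R[i]) (X : {fset H}) : [set` X] `<=` E ->
  energy S ks (lcomb c X) = \sum_(e <- X) z e * csq (c e).
Proof.
move=> XE; apply: (@complexI R); rewrite -gramxx {1}/lcomb.
rewrite gram_suml // rmorph_sum big_seq [RHS]big_seq; apply: eq_bigr => e eX /=.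
have Ee := XE _ eX; have [_ zE] := zP Ee; rewrite gramZl // zE.
by rewrite ipC (ip_lcomb _ bE.1 XE) // eX mulrCA -csqE -rmorphM.
Qed.

(* Where [z e = 0] this weight is [0], as [x / 0 = 0]. *)
Let w k g e := nu k g ^+ 2 * csq '[g, e] / z e.

(** Let [v] be the sum of [<g, e> / z_e e] over finitely many [e], and [t] its energy. Then
    [<g, v> = t], so [<S g, S v> = nu^2 t], and Cauchy-Schwarz gives
    [(nu^2 t)^2 <= nu^2 |S v|^2 <= nu^2 t], that is, [nu^2 t <= 1]. *)
Let w_row k g : k \in ks -> F k g -> (\esum_(e in E) (w k g e)%:E <= 1)%E.
Proof.
move=> kks Fg; apply: esum_le_fset => X XE; rewrite lee_fin.
have [_ /(_ _ Fg)[_ Sg]] := FP k.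
pose c e := (z e)^-1%:C * '[g, e].
pose t := \sum_(e <- X) csq '[g, e] / z e.
have -> : \sum_(e <- X) w k g e = nu k g ^+ 2 * t.
  by rewrite mulr_sumr; apply: eq_bigr => e _; rewrite /w mulrA.
have gv : '[g, lcomb c X] = t%:C.
  rewrite ip_lcombr rmorph_sum; apply: eq_bigr => e _ /=.
  by rewrite /c conj_realM -mulrA [_^* * _]mulrC -csqE -rmorphM mulrC.
have ev : energy S ks (lcomb c X) = t.
  rewrite energy_lcomb //; apply: eq_bigr => e _.
  rewrite /c csqM csqr; have [->|zn0] := eqVneq (z e) 0.
    by rewrite invr0 mul0r mulr0.
  by field.
have t0 : 0 <= t by rewrite -ev energy_ge0.
have sg : sqn (S k g) = nu k g ^+ 2.
  apply: (@complexI R); rewrite -ipxx Sg ipxx.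
  have [[oF _] _] := FP k.
  by rewrite [sqn g]/sqn oF // eqxx mulr1.
have h : (nu k g ^+ 2 * t) ^+ 2 <= nu k g ^+ 2 * t.
  have := cauchy_schwarz (S k g) (S k (lcomb c X)).
  rewrite Sg gv -rmorphM csqr sg => /le_trans; apply.
  by rewrite ler_wpM2l ?sqr_ge0 // -ev sqn_le_energy.
rewrite leNgt; apply/negP => h1; move: h; apply/negP; rewrite -ltNge expr2.
by rewrite ltr_pMr // (lt_trans ltr01).
Qed.

Let w_sum k g : k \in ks -> F k g ->
  \esum_(e in E) (w k g e * z e)%:E = (nu k g ^+ 2)%:E.
Proof.
move=> kks Fg; have [[oF _] /(_ _ Fg)[_ Sg]] := FP k.
transitivity (\esum_(e in E) ((nu k g ^+ 2)%:E * (csq '[g, e])%:E)%E).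
  apply: eq_esum => e Ee; rewrite -EFinM /w; congr _%:E.
  (* If [z e = 0], then [S k e = 0], so the product [nu^2 <g, e>] vanishes and the default value of
     the weight does no harm. *)
  have [ze0|zn0] := eqVneq (z e) 0; last by rewrite divfK.
  rewrite ze0 mulr0; have Se : S k e = 0.
    apply/eqP; rewrite -sqn_eq0 eq_le sqn_ge0 andbT -ze0 -energy_E //.
    exact: sqn_le_energy.
  have := Sg e; rewrite Se ip0r => /esym/eqP; rewrite mulf_eq0 => /orP[].
    by rewrite (inj_eq (@complexI R)) => /eqP ->; rewrite mul0r.
  by move=> /eqP ->; rewrite csq0 mulr0.
rewrite esumZl ?sqr_ge0 // => [|e _]; last by rewrite lee_fin csq_ge0.
by rewrite (parseval _ bE) -EFinM [sqn g]/sqn oF // eqxx mulr1.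
Qed.

Lemma pinching d q : exponent_range d q ->
  le_dir d (\sum_(k <- ks) \esum_(g in F k) ((nu k g ^+ 2) `^ q)%:E)%E
        (\esum_(e in E) (z e `^ q)%:E).
Proof.
move=> dq; have q0 := exponent_range_gt0 dq.
(* The column totals of [w k]. Over all [k] they add up to [1] where [z e > 0]; where [z e = 0] the
   factor [z e ^ q] vanishes. *)
pose c k e := (z e)^-1 * sqn (S k e).
apply: (@le_dir_trans _ _ _ (\sum_(k <- ks) \esum_(e in E) (z e `^ q * c k e)%:E)%E).
  rewrite big_seq [X in le_dir _ _ X]big_seq; apply: le_dir_sum => k kks.
  apply: (@transport _ _ _ _ _ _ _ (w k)) => //.
  - by move=> g e Fg Ee; rewrite /w mulr_ge0 ?invr_ge0 ?z0 // mulr_ge0 ?sqr_ge0 ?csq_ge0.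
  - by move=> g; exact: w_row.
  - by move=> g; exact: w_sum.
  move=> e Ee; rewrite EFinM -(singular_energy (lS k) (cS k) (FP k)) -esumZl.
  - by apply: eq_esum => g Fg; rewrite -EFinM /w (ipC e g) csqJ mulrC.
  - by rewrite invr_ge0 z0.
  - by move=> g _; rewrite lee_fin mulr_ge0 ?sqr_ge0 ?csq_ge0.
rewrite -esum_sum => [|e k Ee _]; last first.
  by rewrite lee_fin mulr_ge0 ?powR_ge0 // mulr_ge0 ?invr_ge0 ?sqn_ge0 ?z0.
suff -> : \esum_(e in E) (\sum_(k <- ks) (z e `^ q * c k e)%:E)%E =
  \esum_(e in E) (z e `^ q)%:E by rewrite /le_dir lexx if_same.
apply: eq_esum => e Ee; rewrite sumEFin -mulr_sumr -mulr_sumr -/(energy S ks e).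
rewrite energy_E //; have [->|zn0] := eqVneq (z e) 0.
  by rewrite powR0 ?mul0r // gt_eqF.
by rewrite mulVf // mulr1.
Qed.

Lemma trace_convexity d q : exponent_range d q ->
  le_dir d (\esum_(e in E) (z e `^ q)%:E)
        (\sum_(i < n) (((r i)^-1 * (r i ^+ 2) `^ q)%:E *
           \esum_(g in G i) ((mu i g ^+ 2) `^ q)%:E))%E.
Proof.
move=> dq; have q0 := exponent_range_gt0 dq.
have r1_ge0 i : 0 <= (r i)^-1 by rewrite invr_ge0 ltW.
have k0 i : 0 <= (r i)^-1 * (r i ^+ 2) `^ q by rewrite mulr_ge0 ?powR_ge0.
(* Jensen is applied first over [i] with weights [1 / r i], then over the singular vectors of each
   [A i], where the weights [|<e, g>|^2] have row and column totals [1] by Parseval in both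
   bases. *)
apply: (@le_dir_trans _ _ _ (\esum_(e in E) (\sum_(i < n)
    ((r i)^-1 * (r i ^+ 2) `^ q)%:E * (sqn (A i e) `^ q)%:E)%E)).
  apply: le_dir_esum => e Ee.
  have wb j : 0 <= r j ^+ 2 * sqn (A j e) by rewrite mulr_ge0 ?sqr_ge0 ?sqn_ge0.
  have h : le_dir d (z e `^ q)%:E
      (\sum_(i < n) (r i)^-1 * (r i ^+ 2 * sqn (A i e)) `^ q)%:E.
    have := @jensen R d q 'I_n [set: 'I_n] (fun i => (r i)^-1)
      (fun i => r i ^+ 2 * sqn (A i e)) (z e) dq.
    rewrite !esum_finType => [|j|j|j]; rewrite ?lee_fin ?mulr_ge0 ?powR_ge0 ?sqn_ge0 ?(ltW (r_gt0 _)) //.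
    rewrite !sumEFin r_sum; apply => //; congr _%:E; rewrite -energy_E // energyE.
    by apply: eq_bigr => i _; field; rewrite gt_eqF.
  suff -> : (\sum_(i < n) ((r i)^-1 * (r i ^+ 2) `^ q)%:E * (sqn (A i e) `^ q)%:E)%E =
      (\sum_(i < n) (r i)^-1 * (r i ^+ 2 * sqn (A i e)) `^ q)%:E by [].
  rewrite -sumEFin; apply: eq_bigr => i _.
  by rewrite -EFinM powRM ?sqr_ge0 ?sqn_ge0 // mulrA.
rewrite esum_sum => [|e i Ee _]; last by rewrite -EFinM lee_fin mulr_ge0 ?powR_ge0.
apply: le_dir_sum => i _; rewrite esumZl //; last by move=> e _; rewrite lee_fin powR_ge0.
have [bG Gmu] := GP i.
suff : le_dir d (\esum_(e in E) (sqn (A i e) `^ q)%:E)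
    (\esum_(g in G i) ((mu i g ^+ 2) `^ q * 1)%:E).
  under [X in le_dir _ _ X]eq_esum do rewrite mulr1.
  by case: (d) => /= h; rewrite lee_wpmul2l // lee_fin.
apply: (@transport _ _ _ _ _ _ _ (fun e g => csq '[e, g])) => //.
- by move=> e g _ _; exact: csq_ge0.
- by move=> g _; exact: sqr_ge0.
- by move=> e Ee; rewrite /= (parseval _ bG) [sqn e]/sqn bE.1 // eqxx.
- move=> e Ee; rewrite -(singular_energy (lA i) (cA i) (GP i)).
  by apply: eq_esum => g _ /=; rewrite mulrC.
move=> g Gg /=; under eq_esum do rewrite ipC csqJ.
by rewrite (parseval _ bE) [sqn g]/sqn bG.1 // eqxx.
Qed.

End Eigenbasis.

Theorem schatten_comparison d q : exponent_range d q ->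
  le_dir d (\sum_(k <- ks) \esum_(g in F k) ((nu k g ^+ 2) `^ q)%:E)%E
        (\sum_(i < n) (((r i)^-1 * (r i ^+ 2) `^ q)%:E *
           \esum_(g in G i) ((mu i g ^+ 2) `^ q)%:E))%E.
Proof.
move=> dq; have [E [z [bE zP]]] := spectral_gram ks lS cS.
exact: le_dir_trans (pinching bE zP dq) (trace_convexity bE zP dq).
Qed.

End CoreInequality.

(** * Pair combinations *)

Lemma sum_ordered_pairs (V : nmodType) n (c : 'I_n -> 'I_n -> V) :
  (forall i, c i i = 0) ->
  \sum_(i < n) \sum_(j < n | (i < j)%N) (c i j + c j i) =
  \sum_(i < n) \sum_(j < n) c i j.
Proof.
move=> c0; under eq_bigr do rewrite big_split /=.
rewrite big_split /= [X in _ + X](exchange_big_dep xpredT) //= -big_split /=.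
apply: eq_bigr => i _; rewrite [RHS](bigID (fun j : 'I_n => (i < j)%N)) /=.
congr (_ + _); rewrite [RHS](bigD1 i) ?ltnn //= c0 add0r.
by apply: eq_bigl => j; rewrite -leqNgt ltn_neqAle andbC.
Qed.

Lemma powR_sqr_half (R : realType) (x p : R) : 0 <= x -> (x ^+ 2) `^ (p / 2) = x `^ p.
Proof. by move=> x0; rewrite -powR_mulrn // -powRrM mulrCA divff ?mulr1. Qed.

Section PairCombinations.
Variables (R : realType) (H : hilbertType R) (n : nat).
Variables (A : 'I_n -> H -> H) (r : 'I_n -> R).
Hypothesis r_gt0 : forall i, 0 < r i.
Hypothesis r_sum : \sum_(i < n) (r i)^-1 = 1.

(* [None] is the index of the sum of all the operators. *)
Definition pair_comb (k : option ('I_n * 'I_n)) : H -> H := fun x =>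
  if k is Some ij then
    (Num.sqrt (r ij.1 / r ij.2))%:C *: A ij.1 x
    - (Num.sqrt (r ij.2 / r ij.1))%:C *: A ij.2 x
  else \sum_(i < n) A i x.

Definition pair_indices : seq (option ('I_n * 'I_n)) :=
  None :: [seq Some ij | ij : 'I_n * 'I_n <- index_enum ('I_n * 'I_n)%type & (ij.1 < ij.2)%N].

Lemma big_pair_indices (V : nmodType) (f : option ('I_n * 'I_n) -> V) :
  \sum_(k <- pair_indices) f k =
  \sum_(i < n) \sum_(j < n | (i < j)%N) f (Some (i, j)) + f None.
Proof.
rewrite /pair_indices big_cons big_map big_filter addrC; congr (_ + _).
by rewrite pair_big_dep /=; apply: eq_bigr => -[].
Qed.

Lemma pair_comb_linear k : (forall i, linear (A i)) -> linear (pair_comb k).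
Proof.
move=> lA c x y; case: k => [[i j]|] /=.
  by rewrite !lA scalerBr !scalerDr opprD !scalerA ![c * _]mulrC addrACA.
by rewrite scaler_sumr -big_split; apply: eq_bigr => i _; exact: lA.
Qed.

Lemma pair_comb_seq_compact k : (forall i, seq_compact (A i)) ->
  seq_compact (pair_comb k).
Proof.
move=> cA; case: k => [[i j]|] /=; last exact: seq_compact_sum.
have := seq_compactD (seq_compactZ (Num.sqrt (r i / r j))%:C (cA i))
  (seq_compactZ (- (Num.sqrt (r j / r i))%:C) (cA j)).
suff -> : (fun x : H => (Num.sqrt (r i / r j))%:C *: A i x
  + - (Num.sqrt (r j / r i))%:C *: A j x) = pair_comb (Some (i, j)) by [].
by apply/funext => x; rewrite scaleNr.
Qed.

Lemma pair_comb_energy x :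
  energy pair_comb pair_indices x = \sum_(i < n) r i * sqn (A i x).
Proof.
(* [c i j + c j i] is the squared norm for the pair, as the two square roots multiply to [1]. Since
   [c i i = 0], the sum extends to all [i] and [j]; its cross terms cancel those of the total sum,
   and the inverses of the [r j] add up to [1]. *)
pose c i j := r i / r j * sqn (A i x) - complex.Re (inner (A i x) (A j x)).
have sqnS : sqn (\sum_(i < n) A i x) =
    \sum_(i < n) \sum_(j < n) complex.Re (inner (A i x) (A j x)).
  rewrite /sqn ip_suml Re_sum; apply: eq_bigr => i _.
  by rewrite ip_sumr Re_sum.
rewrite /energy big_pair_indices /=.
have -> : \sum_(i < n) \sum_(j < n | (i < j)%N) sqn (pair_comb (Some (i, j)) x) =
    \sum_(i < n) \sum_(j < n | (i < j)%N) (c i j + c j i).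
  apply: eq_bigr => i _; apply: eq_bigr => j _ /=.
  have rij : 0 <= r i / r j by rewrite divr_ge0 ?ltW.
  have rji : 0 <= r j / r i by rewrite divr_ge0 ?ltW.
  rewrite sqnB !sqnZ !csqr !sqr_sqrtr // ipZl Re_realM ipZr conjc_real Re_realM.
  rewrite mulrA -sqrtrM // /c (Re_ipC (A i x)).
  have -> : r i / r j * (r j / r i) = 1 by field; rewrite !gt_eqF.
  by rewrite sqrtr1; ring.
rewrite sum_ordered_pairs => [|i]; last by rewrite /c divff ?gt_eqF // mul1r subrr.
rewrite sqnS -big_split; apply: eq_bigr => i _ /=.
rewrite -big_split /=; under eq_bigr do rewrite /c subrK mulrAC.
by rewrite -mulr_sumr r_sum mulr1.
Qed.

End PairCombinations.

(** * Assembly of the two inequalities *)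

Lemma schatten_inequality (R : realType) (H : hilbertType R) (p : R) (n : nat)
    (A : 'I_n -> H -> H) (r : 'I_n -> R) (d : bool) : 0 < p ->
  (forall i, compact_operator (A i)) -> (forall i, 0 < r i) ->
  \sum_(i < n) (r i)^-1 = 1 -> exponent_range d (p / 2) ->
  le_dir d
    (\sum_(i < n) \sum_(j < n | (i < j)%N)
       schatten_norm p ((Num.sqrt (r i / r j))%:C *: A i
                        - (Num.sqrt (r j / r i))%:C *: A j)%R `^ p
     + schatten_norm p (\sum_(i < n) A i)%R `^ p)%E
    (\sum_(i < n) ((r i `^ (p - 1))%R%:E * schatten_norm p (A i) `^ p))%E.
Proof.
move=> p0 KA r0 r1 dp.
have lA i : linear (A i) by case: (KA i).
have cA i : seq_compact (A i) by exact: compact_operator_seq.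
pose S := pair_comb A r; pose ks := pair_indices n.
have lS k : linear (S k) by exact: pair_comb_linear.
have cS k : seq_compact (S k) by exact: pair_comb_seq_compact.
have /choice[F FP] k : exists Bm : set H * (H -> R),
    singular_system (S k) Bm.1 Bm.2 /\
    (schatten_norm p (S k) `^ p = \esum_(e in Bm.1) (Bm.2 e `^ p)%:E)%E.
  have [B [m Bm]] := schatten_norm_singular p0 (lS k) (cS k).
  by exists (B, m).
have /choice[G GP] i : exists Bm : set H * (H -> R),
    singular_system (A i) Bm.1 Bm.2 /\
    (schatten_norm p (A i) `^ p = \esum_(e in Bm.1) (Bm.2 e `^ p)%:E)%E.
  have [B [m Bm]] := schatten_norm_singular p0 (lA i) (cA i).
  by exists (B, m).
(* The comparison with [q = p / 2] concerns squared singular values. *)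
have half B (mu : H -> R) T : @singular_system R H T B mu ->
    \esum_(g in B) ((mu g ^+ 2) `^ (p / 2))%:E = \esum_(g in B) (mu g `^ p)%:E.
  by move=> [_ Bmu]; apply: eq_esum => g /Bmu[m0 _]; rewrite powR_sqr_half.
have := schatten_comparison lS cS lA cA r0 r1 (pair_comb_energy A r0 r1)
  (fun k => (FP k).1) (fun i => (GP i).1) dp.
under eq_bigr => k _ do rewrite (half _ _ _ (FP k).1) -(FP k).2.
under [X in le_dir _ _ X -> _]eq_bigr => i _ do rewrite (half _ _ _ (GP i).1) -(GP i).2.
rewrite big_pair_indices.
have -> : S None = (\sum_(i < n) A i)%R by apply/funext => x; rewrite fct_sumE.
move=> h; congr (le_dir d _ _): h.
apply: eq_bigr => i _; congr (_%:E * _)%E.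
(* The Jensen constant [r^-1 (r^2)^(p / 2)] is [r^(p - 1)]. *)
have rn0 : r i != 0 by rewrite gt_eqF.
rewrite powR_sqr_half ?ltW // powRB ?rn0 ?implybT // powRr1 ?ltW //.
by rewrite mulrC.
Qed.

Theorem corollary3p2 (R : realType) (H : hilbertType R) (hH : separable H)
  (p : R) (hp : 0 < p) (n : nat) (A : 'I_n -> H -> H) (r : 'I_n -> R)
  (hA : forall i, schatten_class p (A i))
  (hr : forall i, 0 < r i) (hr1 : \sum_(i < n) (r i)^-1 = 1) :
  (2 <= p ->
    (\sum_(i < n) ((r i `^ (p - 1))%R%:E * schatten_norm p (A i) `^ p)
     >= \sum_(i < n) \sum_(j < n | (i < j)%N)
          schatten_norm p ((Num.sqrt (r i / r j))%:C *: A i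
                           - (Num.sqrt (r j / r i))%:C *: A j)%R `^ p
        + schatten_norm p (\sum_(i < n) A i)%R `^ p)%E)
  /\
  (p <= 2 ->
    (\sum_(i < n) ((r i `^ (p - 1))%R%:E * schatten_norm p (A i) `^ p)
     <= \sum_(i < n) \sum_(j < n | (i < j)%N)
          schatten_norm p ((Num.sqrt (r i / r j))%:C *: A i
                           - (Num.sqrt (r j / r i))%:C *: A j)%R `^ p
        + schatten_norm p (\sum_(i < n) A i)%R `^ p)%E).
Proof.
have KA i : compact_operator (A i) by case: (hA i).
split=> p2.
  by apply: (@schatten_inequality _ _ _ _ _ _ true); rewrite //= ler_pdivlMr ?mul1r.
apply: (@schatten_inequality _ _ _ _ _ _ false) => //=.
by rewrite divr_gt0 //= ler_pdivrMr ?mul1r.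
Qed.
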